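(* Let $\mathfrak G=(\mathfrak X,\mathfrak E)$ be a finite connected graph without dead ends, with universal cover $\widetilde{\mathfrak G}$, boundary $\widetilde\Omega$ of $\widetilde{\mathfrak G}$ and group of deck transformations $\Gamma$, and let $z\in\mathbb C\setminus\{0\}$. Then: (1) The edge Poisson transform of $\widetilde{\mathfrak G}$ induces an isomorphism $\mathcal D'(\widetilde\Omega)^{\Gamma,z}\cong\mathcal E_z(\Delta^{\mathrm e};\mathrm{Maps}(\mathfrak E,\mathbb C))$: for $\mu\in\mathcal D'(\widetilde\Omega)^{\Gamma,z}$ the function $\mathcal P^{\mathrm e}_z\mu$ on $\widetilde{\mathfrak E}$ is $\Gamma$-invariant, and sending $\mu$ to the function on $\mathfrak E$ it descends to is the isomorphism. (2) The pullback to limit points of paths yields an isomorphism $\mathcal D'(\widetilde\Omega)^{\Gamma,z}\cong\mathcal E_z(\mathcal L';\mathcal D'(\mathfrak P))$, which sends $\mu$ to the unique $u\in\mathcal D'(\mathfrak P)$ with $\pi_{\mathfrak P}^\star u=p_zB^\star\mu$. (3) There is an isomorphism of vector spaces $\mathcal E_z(\mathcal L';\mathcal D'(\mathfrak P))\cong\mathcal E_z(\mathcal L;C^{\mathrm{lc}}(\mathfrak P))$, and hence $\mathcal E_z(\Delta^{\mathrm e};\mathrm{Maps}(\mathfrak E,\mathbb C))\cong\mathcal E_z(\mathcal L;C^{\mathrm{lc}}(\mathfrak P))$.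
   Context: Graphs: $\mathfrak X$ is the set of vertices and $\mathfrak E\subseteq\mathfrak X^2$ the set of directed edges, symmetric under $(a,b)\mapsto(b,a)$, without loops. For $\vec e=(a,b)$ put $\iota(\vec e)=a$, $\tau(\vec e)=b$, $\vec e^{\,\mathrm{op}}=(b,a)$. A chain is a sequence of edges with $\tau(\vec e_i)=\iota(\vec e_{i+1})$ and $\vec e_{i+1}\ne\vec e_i^{\,\mathrm{op}}$. No dead ends: every directed edge starts an infinite chain. For an operator $T$ on a space $U$, $\mathcal E_z(T;U)=\{f\in U\mid Tf=zf\}$. Edge Laplacian: $\Delta^{\mathrm e}f(\vec e)=\sum_{\iota(\vec e\,')=\tau(\vec e),\ \vec e\,'\ne\vec e^{\,\mathrm{op}}}f(\vec e\,')$. Paths: $\mathfrak P$ is the set of infinite chains $(\vec e_1,\vec e_2,\dots)$ with the topology whose basic open sets consist of all chains with a prescribed finite initial segment. $\sigma$ is the shift $(\vec e_1,\vec e_2,\dots)\mapsto(\vec e_2,\vec e_3,\dots)$ and $(\mathcal LF)(\mathbf e)=\sum_{\sigma(\mathbf e')=\mathbf e}F(\mathbf e')$. $C^{\mathrm{lc}}(\mathfrak P)$ (resp. $C^{\mathrm{lc}}_c(\mathfrak P)$) is the space of locally constant complex functions (with compact support); $\mathcal D'(\mathfrak P)$ is the algebraic dual of $C_c^{\mathrm{lc}}(\mathfrak P)$ ($=C^{\mathrm{lc}}(\mathfrak P)$ for finite $\mathfrak G$) and $\mathcal L'$ the transpose of $\mathcal L$. The same notions are used for $\widetilde{\mathfrak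 G}$, with path space $\widetilde{\mathfrak P}$. Universal cover: $\widetilde{\mathfrak G}=(\widetilde{\mathfrak X},\widetilde{\mathfrak E})$ is the simply connected cover of the underlying undirected graph, each undirected edge being replaced by two opposite directed ones; it is a tree of bounded degree. Its boundary $\widetilde\Omega$ is the set of infinite non-backtracking vertex paths modulo sharing infinitely many vertices; $[x,\omega[$ is the representative of $\omega$ starting at $x$; $\partial_+\vec e$ is the set of $\omega$ such that $[\iota(\vec e),\omega[$ starts with $\vec e$; these sets generate the topology. $\mathcal D'(\widetilde\Omega)$ is the algebraic dual of the space of locally constant functions $\widetilde\Omega\to\mathbb C$. Fix a base point $o\in\widetilde{\mathfrak X}$; $\langle x,\omega\rangle=d(o,y)-d(x,y)$ where $[o,\omega[\,\cap\,[x,\omega[\,=[y,\omega[$. Put $p_z(x,\omega)=z^{\langle x,\omega\rangle}$ and $\mathcal P^{\mathrm e}_z\mu(\vec e)=\int_{\partial_+\vec e}z^{\langle\iota(\vec e),\omega\rangle}d\mu(\omega)$. Invariants: for an automorphism $g$ of $\widetilde{\mathfrak G}$ let $\pi_z(g)\mu=g_*\big(z^{-\langle go,g\,\cdot\,\rangle}\mu\big)$ (multiply $\mu$ by the locally constant function $\omega\mapsto z^{-\langle go,g\omega\rangle}$, then push forward by $g$). $\mathcal D'(\widetilde\Omega)^{\Gamma,z}=\{\mu\mid\pi_z(\gamma)\mu=\mu\ \forall\gamma\in\Gamma\}$. Pullbacks: identify $\widetilde{\mathfrak P}\cong\widetilde{\mathfrak X}\times\widetilde\Omega$ (initial vertex,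 end point). For $f\in C_c^{\mathrm{lc}}(\widetilde{\mathfrak P})$ let $B_\star f(\omega)=\sum_{x\in\widetilde{\mathfrak X}}f(x,\omega)$, let $B^\star\mu=\mu\circ B_\star$ and $(p_zB^\star\mu)(f)=(B^\star\mu)(p_zf)$. Let $\pi_{\mathfrak P}\colon\widetilde{\mathfrak P}\to\mathfrak P$ be the edgewise projection; for $f\in C_c^{\mathrm{lc}}(\widetilde{\mathfrak P})$ let $\pi_{\mathfrak P,\star}f\in C^{\mathrm{lc}}(\mathfrak P)$ be the function with $(\pi_{\mathfrak P,\star}f)\circ\pi_{\mathfrak P}=\sum_{\gamma\in\Gamma}f(\gamma^{-1}\,\cdot\,)$, and $\pi_{\mathfrak P}^\star u=u\circ\pi_{\mathfrak P,\star}$. *)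

(* Defs.v *)
From HB Require Import structures.
From mathcomp Require Import all_boot all_order all_algebra.
From mathcomp Require Import complex finmap.
From mathcomp Require Import all_classical all_reals.
From mathcomp Require Import topology.

Set Implicit Arguments.
Unset Strict Implicit.
Unset Printing Implicit Defensive.
Import Order.TTheory GRing.Theory Num.Theory.

Local Open Scope classical_set_scope.
Local Open Scope ring_scope.

Record graph := Graph {
  vertex :> choiceType;
  edge : rel vertex;
  edge_sym : symmetric edge;
  edge_irr : irreflexive edge }.

Record fin_graph := FinGraph {
  fin_graph_graph :> graph;
  finite_vertices : finite_set [set: fin_graph_graph] }.

Definition connected_graph (G : graph) : Prop :=
  forall x y : G, exists2 s, path (@edge G) x s & last x s = y.

Definition dedge (G : graph) := {e : G * G | edge e.1 e.2}.

Section Edges.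
Variable G : graph.
Implicit Types e : dedge G.

Definition src e : G := (val e).1.
Definition tgt e : G := (val e).2.

Lemma edge_op_subproof e : edge (tgt e) (src e).
Proof. by rewrite edge_sym; exact: (valP e). Qed.
Definition edge_op e : dedge G := exist _ (tgt e, src e) (edge_op_subproof e).

End Edges.

(* Edges of a chain are numbered from 0. *)
Record chain (G : graph) := Chain {
  cedge :> nat -> dedge G;
  chainP : forall i,
    tgt (cedge i) = src (cedge i.+1) /\ cedge i.+1 <> edge_op (cedge i) }.

HB.instance Definition _ (G : graph) := gen_eqMixin (chain G).
HB.instance Definition _ (G : graph) := gen_choiceMixin (chain G).

Definition no_dead_ends (G : graph) : Prop :=
  forall e : dedge G, exists c : chain G, c 0%N = e.

Section PathSpace.
Variable G : graph.

Definition cylinder (c : chain G) (n : nat) : set (chain G) :=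
  [set c' | forall i, (i < n)%N -> c' i = c i].

Definition cylinders : set (set (chain G)) :=
  [set U | exists c n, U = cylinder c n].

Let cylinders_cover : \bigcup_(U in cylinders) U = setT.
Proof.
apply/seteqP; split=> // c _; exists (cylinder c 0) => //.
by exists c, 0%N.
Qed.

Let cylinders_join (U V : set (chain G)) c : cylinders U -> cylinders V ->
  U c -> V c -> exists W, [/\ cylinders W, W c & W `<=` U `&` V].
Proof.
move=> [a [n ->]] [b [m ->]] ac bc; exists (cylinder c (maxn n m)); split=> //.
  by exists c, (maxn n m).
move=> d cd; split=> i ilt.
  by rewrite cd ?ac // leq_max ilt.
by rewrite cd ?bc // leq_max ilt orbT.
Qed.

HB.instance Definition _ := isBaseTopological.Build (chain G)
  (I := set (chain G)) (D := cylinders) (b := id)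
  cylinders_cover cylinders_join.

Lemma chain_shift_subproof (c : chain G) i :
  tgt (c i.+1) = src (c i.+2) /\ c i.+2 <> edge_op (c i.+1).
Proof. exact: chainP. Qed.
Definition chain_shift (c : chain G) : chain G :=
  Chain (cedge := fun i => c i.+1) (chain_shift_subproof c).

End PathSpace.

(* Local bijectivity; surjectivity is automatic when the target is connected
   and the source is nonempty. *)
Record covering (H G : graph) := Covering {
  cov_fun :> H -> G;
  cov_bij : forall x,
    set_bij [set y | edge x y] [set y | edge (cov_fun x) y] cov_fun }.

Section CoveringMaps.
Variables (H G : graph) (p : covering H G).

Lemma cov_edge x y : edge x y -> edge (p x) (p y).
Proof. by move=> xy; case: (cov_bij p x) => pf _ _; exact: pf. Qed.

Definition emap (e : dedge H) : dedge G :=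
  exist _ (p (src e), p (tgt e)) (cov_edge (valP e)).

Lemma cmap_subproof (c : chain H) i :
  tgt (emap (c i)) = src (emap (c i.+1)) /\
  emap (c i.+1) <> edge_op (emap (c i)).
Proof.
have [ts nb] := chainP c i; split; first by rewrite /tgt /src /= ts.
move=> [_ pt]; apply: nb; apply/val_inj => /=.
rewrite [LHS]surjective_pairing -/(src _) -/(tgt _) -ts; congr pair.
have [_ inj _] := cov_bij p (tgt (c i)).
apply: inj => //; rewrite inE /=; last exact: edge_op_subproof.
by rewrite ts; exact: (valP (c i.+1)).
Qed.
Definition cmap (c : chain H) : chain G :=
  Chain (cedge := fun i => emap (c i)) (cmap_subproof c).

End CoveringMaps.

Record automorphism (G : graph) := MkAut {
  aut_fun : G -> G;
  aut_invf : G -> G;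
  aut_funK : cancel aut_fun aut_invf;
  aut_invK : cancel aut_invf aut_fun;
  aut_edge : forall x y, edge (aut_fun x) (aut_fun y) = edge x y }.

HB.instance Definition _ (G : graph) := gen_eqMixin (automorphism G).
HB.instance Definition _ (G : graph) := gen_choiceMixin (automorphism G).

Section Automorphisms.
Variable G : graph.

Lemma aut_cov_subproof (g : automorphism G) x :
  set_bij [set y | edge x y] [set y | edge (aut_fun g x) y] (aut_fun g).
Proof.
split=> [y /= xy | y y' _ _ /(can_inj (aut_funK g)) // | y /= gxy].
  by rewrite aut_edge.
by exists (aut_invf g y); rewrite /= ?aut_invK // -(aut_edge g) aut_invK.
Qed.
Definition aut_cov (g : automorphism G) : covering G G :=
  Covering (aut_cov_subproof g).

Lemma aut_inv_subproof (g : automorphism G) x y :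
  edge (aut_invf g x) (aut_invf g y) = edge x y.
Proof. by rewrite -(aut_edge g) !aut_invK. Qed.
Definition aut_inv (g : automorphism G) : automorphism G :=
  MkAut (aut_invK g) (aut_funK g) (aut_inv_subproof g).

End Automorphisms.
Coercion aut_cov : automorphism >-> covering.

Definition deck (H G : graph) (p : covering H G) : set (automorphism H) :=
  [set g | forall x, p (g x) = p x].

(* A graph has trivial fundamental group at each of its vertices iff no reduced
   edge path of positive length is closed. *)
Definition simply_connected (G : graph) : Prop :=
  connected_graph G /\
  forall (w : nat -> G) (n : nat), (0 < n)%N ->
    (forall i, (i < n)%N -> edge (w i) (w i.+1)) ->
    (forall i, (i.+1 < n)%N -> w i.+2 <> w i) -> w n <> w 0%N.

Record tree := Tree {
  tree_graph :> graph;
  tree_sc : simply_connected tree_graph }.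

Record ray (G : graph) := Ray {
  rvertex :> nat -> G;
  rayP : forall i,
    edge (rvertex i) (rvertex i.+1) /\ rvertex i.+2 <> rvertex i }.

HB.instance Definition _ (G : graph) := gen_eqMixin (ray G).
HB.instance Definition _ (G : graph) := gen_choiceMixin (ray G).

Section RaysChains.
Variable G : graph.

Definition ray_class (r : ray G) : set (ray G) :=
  [set r' | infinite_set (range r `&` range r')].

Lemma chain_ray_subproof (c : chain G) i :
  edge (src (c i)) (src (c i.+1)) /\ src (c i.+2) <> src (c i).
Proof.
have [ts nb] := chainP c i; have [ts' _] := chainP c i.+1.
split; first by rewrite -ts; exact: (valP (c i)).
move=> ss; apply: nb; apply/val_inj => /=.
by rewrite [LHS]surjective_pairing -/(src _) -/(tgt _) -ts ts' ss.
Qed.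
Definition chain_ray (c : chain G) : ray G :=
  Ray (rvertex := fun i => src (c i)) (chain_ray_subproof c).

Lemma ray_chain_subproof (r : ray G) (f : nat -> dedge G) :
  (forall i, val (f i) = (r i, r i.+1)) ->
  forall i, tgt (f i) = src (f i.+1) /\ f i.+1 <> edge_op (f i).
Proof.
move=> fE i; split; first by rewrite /tgt /src !fE.
move=> /(congr1 val); rewrite fE /= /tgt /src fE /= => -[]; exact: (rayP r i).2.
Qed.
Definition ray_chain (r : ray G) : chain G :=
  Chain (ray_chain_subproof
    (f := fun i => exist _ (r i, r i.+1) (proj1 (rayP r i))) (fun=> erefl)).

End RaysChains.

Section Boundary.
Variable T : tree.

(* Sharing infinitely many vertices is an equivalence relation on the rays of a
   tree; the boundary is the set of its classes. *)
Definition is_ray_class (w : set (ray T)) : bool :=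
  `[< exists r, w = ray_class r >].
Definition boundary := {w : set (ray T) | is_ray_class w}.
HB.instance Definition _ := Choice.on boundary.

Lemma bclass_subproof (r : ray T) : is_ray_class (ray_class r).
Proof. by apply/asboolP; exists r. Qed.
Definition bclass (r : ray T) : boundary := exist _ (ray_class r) (bclass_subproof r).

Implicit Types (x y o : T) (w : boundary) (r : ray T).

Lemma ray_inj r : injective r.
Proof.
suff H i j : (i < j)%N -> r j <> r i.
  move=> i j rij; case: (ltngtP i j) => // /H; first by rewrite rij.
  by rewrite rij.
move=> ij; have [_ /(_ (fun k => r (i + k)%N) (j - i)%N)] := tree_sc T.
rewrite subn_gt0 subnKC ?(ltnW ij)// addn0; apply => // k _; rewrite !addnS.
  by case: (rayP r (i + k)%N).
by case: (rayP r (i + k)%N).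
Qed.

Lemma ray_move x s r : path (@edge T) x s -> last x s = r 0%N ->
  exists r' : ray T, r' 0%N = x /\
    exists k l, forall i, r' (k + i)%N = r (l + i)%N.
Proof.
elim: s x => [|y s IHs] x /=; first by move=> _ ->; exists r; split=> //; exists 0, 0.
move=> /andP[xy ys] /(IHs _ ys)[q [q0 [k [l ql]]]].
have [xq1|xq1] := EM (q 1%N = x).
  have tP i : edge (q i.+1) (q i.+2) /\ q i.+3 <> q i.+1 by exact: rayP.
  exists (Ray (rvertex := fun i => q i.+1) tP); split=> //=.
  by exists k, l.+1 => i; rewrite -addnS ql addnS.
pose f i := if i is i'.+1 then q i' else x.
have fP i : edge (f i) (f i.+1) /\ f i.+2 <> f i.
  case: i => [|i] /=; last exact: rayP.
  by rewrite q0.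
by exists (Ray fP); split=> //; exists k.+1, l.
Qed.

Lemma ray_from_subproof x w : exists r, sval w r /\ r 0%N = x.
Proof.
case: w => w /=; move/asboolP => [r ->].
have [conn _] := tree_sc T.
have [s xs lxs] := conn x (r 0%N).
have [q [q0 [k [l ql]]]] := ray_move xs lxs.
exists q; split=> //; rewrite /ray_class /=.
apply: (@sub_infinite_set _ [set r (l + i)%N | i in [set: nat]]).
  by move=> _ [i _ <-]; split; [exists (l + i)%N | exists (k + i)%N].
have inj : {in [set: nat] &, injective (fun i => r (l + i)%N)}.
  by move=> i j _ _ /ray_inj/addnI.
by rewrite (eq_finite_set (inj_card_eq inj)); exact: infinite_nat.
Qed.

Definition ray_from x w : ray T := sval (cid (ray_from_subproof x w)).

Definition chain_from x w : chain T := ray_chain (ray_from x w).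

Definition endpoint (c : chain T) : boundary := bclass (chain_ray c).

Definition bd_plus (e : dedge T) : set boundary :=
  [set w | ray_from (src e) w 1%N = tgt e].

HB.instance Definition _ := isSubBaseTopological.Build boundary
  (I := set boundary) (range bd_plus) id.

Lemma tree_dist_subproof x y : exists n,
  `[< exists s, [/\ path (@edge T) x s, last x s = y & size s = n] >].
Proof.
have [conn _] := tree_sc T; have [s xs lxs] := conn x y.
by exists (size s); apply/asboolP; exists s.
Qed.
Definition tree_dist x y : nat := ex_minn (tree_dist_subproof x y).

(* The unique [y] with [[o, w[ `&` [x, w[ = [y, w[]. *)
Definition confluent o x w : T :=
  xget x [set y | range (ray_from o w) `&` range (ray_from x w) =
                  range (ray_from y w)].

Definition horo_bracket o x w : int :=
  (tree_dist o (confluent o x w))%:Z - (tree_dist x (confluent o x w))%:Z.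

Lemma ray_map_subproof (g : automorphism T) r i :
  edge (g (r i)) (g (r i.+1)) /\ g (r i.+2) <> g (r i).
Proof.
have [ed nb] := rayP r i; split; first exact: cov_edge.
by move=> /(can_inj (aut_funK g)).
Qed.
Definition ray_map (g : automorphism T) r : ray T := Ray (ray_map_subproof g r).

Lemma brep_subproof w : exists r, w = bclass r.
Proof. by case: (asboolP _ (valP w)) => r wr; exists r; exact: val_inj. Qed.

(* Independent of the chosen ray, [g] being injective on vertices. *)
Definition bmap (g : automorphism T) w : boundary :=
  bclass (ray_map g (sval (cid (brep_subproof w)))).

End Boundary.

Section LinearAlgebra.
Variable K : fieldType.

Definition is_subspace (V : lmodType K) (A : set V) : Prop :=
  A 0 /\ forall a u v, A u -> A v -> A (a *: u + v).

Definition linear_iso (V W : lmodType K) (A : set V) (B : set W) (f : V -> W) :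
    Prop :=
  [/\ is_subspace A, is_subspace B,
      forall a u v, A u -> A v -> f (a *: u + v) = a *: f u + f v &
      set_bij A B f].

Definition op_eigenspace (V : lmodType K) (A : V -> V) (z : K) : set V :=
  [set v | A v = z *: v].

Definition linear_pred (V : lmodType K) : {pred V -> K^o} :=
  fun u => `[< linear u >].
Arguments linear_pred : clear implicits.

Record alg_dual (V : lmodType K) := AlgDual {
  dual_fun :> V -> K^o;
  dual_funP : dual_fun \in linear_pred V }.

Section AlgDual.
Variable V : lmodType K.

Let linear_pred_closed : submod_closed (linear_pred V).
Proof.
split.
  by apply/asboolP => a u v; rewrite /= scaler0 addr0.
move=> k f g /asboolP lf /asboolP lg; apply/asboolP => a u v /=.
rewrite !fctE lf lg !scalerDr !scalerA [k * a]mulrC !addrA; congr (_ + _).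
by rewrite addrAC.
Qed.
HB.instance Definition _ :=
  GRing.isSubmodClosed.Build K (V -> K^o) (linear_pred V) linear_pred_closed.

HB.instance Definition _ := [isSub for @dual_fun V].
HB.instance Definition _ := [Choice of alg_dual V by <:].
HB.instance Definition _ := [SubChoice_isSubLmodule of alg_dual V by <:].

Lemma transpose_subproof (A : {linear V -> V}) (u : alg_dual V) :
  (u \o A : V -> K^o) \in linear_pred V.
Proof.
have /asboolP lu := dual_funP u.
by apply/asboolP => a v w /=; rewrite linearP lu.
Qed.
Definition transpose (A : {linear V -> V}) (u : alg_dual V) : alg_dual V :=
  AlgDual (transpose_subproof A u).

End AlgDual.
End LinearAlgebra.

Section FunctionSpaces.
Variables (K : fieldType) (X : topologicalType).

Definition locally_constant (f : X -> K^o) : Prop :=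
  forall x, \forall y \near x, f y = f x.

Definition compact_support (f : X -> K^o) : Prop :=
  compact (closure [set x | f x != 0]).

Definition lc_pred : {pred X -> K^o} := fun f => `[< locally_constant f >].

Definition lcc_pred : {pred X -> K^o} :=
  fun f => `[< locally_constant f /\ compact_support f >].

Let locally_constantP a f g : locally_constant f -> locally_constant g ->
  locally_constant (a *: f + g).
Proof.
move=> lf lg x; near=> y; rewrite /= !fctE.
by congr (_ *: _ + _); near: y; [exact: lf|exact: lg].
Unshelve. all: by end_near. Qed.

Let locally_constant0 : locally_constant 0.
Proof. by move=> x; near=> y. Unshelve. all: by end_near. Qed.

Let lc_closed : submod_closed lc_pred.
Proof.
split; first exact/asboolP.
by move=> a f g /asboolP lf /asboolP lg; apply/asboolP/locally_constantP.
Qed.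
HB.instance Definition _ :=
  GRing.isSubmodClosed.Build K (X -> K^o) lc_pred lc_closed.

Let lcc_closed : submod_closed lcc_pred.
Proof.
split.
  apply/asboolP; split=> //; rewrite /compact_support.
  have -> : [set x | (0 : X -> K^o) x != 0] = set0 :> set X.
    by apply/seteqP; split=> // x /=; rewrite eqxx.
  by rewrite closure0; exact: compact0.
move=> a f g /asboolP[lf cf] /asboolP[lg cg]; apply/asboolP; split.
  exact: locally_constantP.
apply: (subclosed_compact _ (compactU cf cg)); first exact: closed_closure.
rewrite -closureU; apply: closureS => x /=; rewrite !fctE => afg.
have [f0|] := eqVneq (f x) 0; last by left.
by right; move: afg; rewrite f0 scaler0 add0r.
Qed.
HB.instance Definition _ :=
  GRing.isSubmodClosed.Build K (X -> K^o) lcc_pred lcc_closed.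

Record Clc := MkClc { Clc_fun :> X -> K^o; Clc_funP : Clc_fun \in lc_pred }.
HB.instance Definition _ := [isSub for Clc_fun].
HB.instance Definition _ := [Choice of Clc by <:].
HB.instance Definition _ := [SubChoice_isSubLmodule of Clc by <:].

Record Clcc :=
  MkClcc { Clcc_fun :> X -> K^o; Clcc_funP : Clcc_fun \in lcc_pred }.
HB.instance Definition _ := [isSub for Clcc_fun].
HB.instance Definition _ := [Choice of Clcc by <:].
HB.instance Definition _ := [SubChoice_isSubLmodule of Clcc by <:].

(* Functions outside of the respective subspace are sent to 0. *)
Definition to_Clc (f : X -> K^o) : Clc := insubd (0 : Clc) f.
Definition to_Clcc (f : X -> K^o) : Clcc := insubd (0 : Clcc) f.

End FunctionSpaces.
Arguments lc_pred {K X}.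
Arguments lcc_pred {K X}.

Section Operators.
Variable K : fieldType.

Definition edge_laplacian (G : graph) (f : dedge G -> K^o) : dedge G -> K^o :=
  fun e => \sum_(e' \in [set e' | src e' = tgt e /\ e' <> edge_op e]) f e'.

Definition transfer_fun (G : graph) (F : chain G -> K^o) : chain G -> K^o :=
  fun c => \sum_(c' \in [set c' | chain_shift c' = c]) F c'.

End Operators.

Section Transfer.
Variables (K : fieldType) (G : fin_graph).
Implicit Types (c d : chain G) (F : chain G -> K^o).

Lemma chain_eqP c d : (forall i, c i = d i) -> c = d.
Proof.
case: c d => [c cP] [d dP] /= /funext cd.
by move: dP; rewrite -cd => dP; congr Chain; exact: Prop_irrelevance.
Qed.

Lemma nbhs_cylinder c (U : set (chain G)) :
  nbhs c U <-> exists n, cylinder c n `<=` U.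
Proof.
rewrite nbhsE; split=> [[V [Vop Vc] VU]|[n cU]].
  move: Vop Vc VU => -[D' D'cyl <-] [W D'W Wc] VU.
  have [a [n Wn]] := D'cyl _ D'W; exists n => d cd; apply: VU; exists W => //.
  rewrite /= Wn in Wc *; move=> i ilt; rewrite cd//; exact: Wc.
exists (cylinder c n) => //; split=> //.
exists [set cylinder c n]; last by rewrite bigcup_set1.
by move=> _ ->; exists c, n.
Qed.

Lemma finite_dedge : finite_set [set: dedge G].
Proof.
have finGG : finite_set [set: G * G].
  by rewrite -setXTT; apply: finite_setX; exact: finite_vertices.
have inj : {in [set: dedge G] &, injective (val : dedge G -> G * G)}.
  by move=> x y _ _; exact: val_inj.
rewrite -(eq_finite_set (inj_card_eq inj)).
exact: sub_finite_set finGG.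
Qed.

Lemma finite_fiber c : finite_set [set c' | chain_shift c' = c].
Proof.
have inj : {in [set c' | chain_shift c' = c] &, injective (fun c' => c' 0%N)}.
  move=> c1 c2; rewrite !inE /= => s1 s2 c12; apply: chain_eqP => -[//|i].
  by rewrite -[LHS]/(chain_shift c1 i) -[RHS]/(chain_shift c2 i) s1 s2.
rewrite -(eq_finite_set (inj_card_eq inj)).
exact: sub_finite_set finite_dedge.
Qed.

Lemma glue_subproof c' d : d 0%N = c' 1%N ->
  forall i, let f := fun i => if i is j.+1 then d j else c' 0%N in
  tgt (f i) = src (f i.+1) /\ f i.+1 <> edge_op (f i).
Proof.
move=> dc [|i] /=; last exact: chainP.
by rewrite dc; exact: chainP.
Qed.

Definition glue c' d : chain G :=
  if pselect (d 0%N = c' 1%N) is left h then Chain (glue_subproof h) else d.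

Lemma transfer_lc F : locally_constant F -> locally_constant (transfer_fun F).
Proof.
move=> lF c.
have /choice[n nP] : forall c', exists n, forall d, cylinder c' n d ->
    F d = F c'.
  by move=> c'; have /nbhs_cylinder[n nF] := lF c'; exists n.
pose S := fset_set [set c' | chain_shift c' = c].
pose N := \max_(c' <- S) n c'.
apply/nbhs_cylinder; exists N.+1 => d cd; rewrite /transfer_fun.
have bij : set_bij [set c' | chain_shift c' = c] [set c' | chain_shift c' = d] (glue^~ d).
  have tl c' : chain_shift c' = c -> d 0%N = c' 1%N.
    by move=> sc; rewrite cd// -sc.
  split.
  - move=> c' /= sc; rewrite /glue; case: pselect => [h|/(_ (tl _ sc))//].
    by apply: chain_eqP => i.
  - move=> c1 c2; rewrite !inE /= => s1 s2; rewrite /glue.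
    case: pselect => [h1|/(_ (tl _ s1))//].
    case: pselect => [h2|/(_ (tl _ s2))//].
    move=> /(congr1 (fun x : chain G => x 0%N)) /= c12.
    apply: chain_eqP => -[//|i].
    by rewrite -[LHS]/(chain_shift c1 i) -[RHS]/(chain_shift c2 i) s1 s2.
  - move=> d' /= sd.
    have h : c 0%N = d' 1%N by rewrite -cd// -sd.
    have h' : d 0%N = Chain (glue_subproof h) 1%N by rewrite /= cd.
    exists (Chain (glue_subproof h)); first exact: chain_eqP.
    rewrite /glue; case: pselect => [h1|//].
    by apply: chain_eqP => -[//|i] /=; rewrite -sd.
rewrite (reindex_fsbig _ _ _ _ bij); apply: eq_fsbigr => c'; rewrite inE /= => sc.
rewrite /glue; case: pselect => [h|hn]; last by case: hn; rewrite cd// -sc.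
apply: nP => -[//|i] iN /=.
rewrite cd; first by rewrite -sc.
have nN : (n c' <= N)%N.
  apply: leq_bigmax_seq => //.
  by rewrite in_fset_set ?inE//; exact: finite_fiber.
by rewrite ltnS; apply: ltnW; apply: ltnW; exact: leq_trans iN nN.
Qed.

Lemma transfer_op_subproof (F : Clc K (chain G)) :
  transfer_fun F \in lc_pred.
Proof. by have /asboolP lF := Clc_funP F; exact/asboolP/transfer_lc. Qed.
Definition transfer_op (F : Clc K (chain G)) : Clc K (chain G) :=
  MkClc (transfer_op_subproof F).

Lemma transfer_op_linear : linear transfer_op.
Proof.
move=> a F1 F2; apply/val_inj/funext => c.
rewrite /= /transfer_fun fsbig_split; last exact: finite_fiber.
by congr (_ + _); exact: esym (mulr_fsumr a _ _).
Qed.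
HB.instance Definition _ :=
  GRing.isLinear.Build K (Clc K (chain G)) (Clc K (chain G)) _ transfer_op
    transfer_op_linear.

End Transfer.

(* [to_Clc] and [to_Clcc] are only applied to functions which do belong to the
   respective spaces when [T] is locally finite, e.g. when it covers a finite
   graph; their default value 0 is then never used. *)
Section Boundary.
Variables (K : fieldType) (T : tree) (o : T) (z : K).
Implicit Types mu : alg_dual (Clc K (boundary T)).

Definition edge_poisson mu : dedge T -> K^o := fun e =>
  mu (to_Clc (fun w =>
    if w \in bd_plus e then z ^ horo_bracket o (src e) w else 0)).

(* The push-forward along [g] of the product of [mu] with the locally constant
   function [w |-> z ^ (- horo_bracket o (g o) (bmap g w))]. *)
Definition pi_z (g : automorphism T) mu : Clc K (boundary T) -> K^o := fun f =>
  mu (to_Clc (fun w => z ^ (- horo_bracket o (g o) (bmap g w)) * f (bmap g w))).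

Definition invariants (Gamma : set (automorphism T)) :
    set (alg_dual (Clc K (boundary T))) :=
  [set mu | forall g, Gamma g -> pi_z g mu = mu].

(* [chain T] is identified with [T * boundary T] through
   [(x, w) |-> chain_from x w], with inverse
   [c |-> (src (c 0), endpoint c)]. *)
Definition B_push (f : Clcc K (chain T)) : Clc K (boundary T) :=
  to_Clc (fun w => \sum_(x \in [set: T]) f (chain_from x w)).

Definition B_pull mu : Clcc K (chain T) -> K^o := fun f => mu (B_push f).

Definition p_z (f : Clcc K (chain T)) : Clcc K (chain T) :=
  to_Clcc (fun c : chain T => z ^ horo_bracket o (src (c 0%N)) (endpoint c) * f c).

Definition p_z_mul (u : Clcc K (chain T) -> K^o) : Clcc K (chain T) -> K^o :=
  fun f => u (p_z f).

End Boundary.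

Section Projection.
Variables (K : fieldType) (T : tree) (G : graph) (p : covering T G).

(* The function in question exists and is unique if [G] is finite and
   connected and [T] is nonempty. *)
Definition path_push (f : Clcc K (chain T)) : Clc K (chain G) :=
  xget 0 [set F : Clc K (chain G) | forall c,
    F (cmap p c) = \sum_(g \in deck p) f (cmap (aut_inv g) c)].

(* Distributions on [chain G] are functionals on all of [Clc K (chain G)]:
   every function has compact support as soon as [G] is finite. *)
Definition path_pull (u : alg_dual (Clc K (chain G))) :
    Clcc K (chain T) -> K^o :=
  fun f => u (path_push f).

End Projection.

(* Main.v *)
Require Import Defs.
From HB Require Import structures.
From mathcomp Require Import all_boot all_order all_algebra.
From mathcomp Require Import complex finmap.
From mathcomp Require Import all_classical all_reals.
From mathcomp Require Import topology.
From mathcomp Require Import zify.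

Set Implicit Arguments.
Unset Strict Implicit.
Unset Printing Implicit Defensive.

Import Order.TTheory GRing.Theory Num.Theory.
Local Open Scope classical_set_scope.
Local Open Scope ring_scope.

(* A path of [G] lifts uniquely at each point of a fiber of [p], so the paths of
   [G] starting at [p x] are the ends of [T] (seen from [x]).  Restricting an
   eigendistribution [u] of the transposed transfer operator to these paths gives
   a boundary distribution [mu_x]; the eigenvalue equation says that
   [mu_y = z ^ <y, .> / z ^ <x, .> mu_x] for adjacent, hence for all, [x] and [y].
   As [mu_(g x)] is the translate of [mu_x] by a deck transformation [g], this is
   the invariance of [mu_o].  Conversely an invariant [mu] defines functionals
   [f |-> mu (z ^ <x, .> f)] on the paths from [p x], which depend on [p x] only;
   their sum over the vertices of [G] is [u].
   The edge Poisson transform of [mu_o] is [e |-> u (paths starting with p e)].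
   These values determine [u]: iterating the transfer operator turns a locally
   constant function into a function of the first edge, on which the transfer
   operator is dual to the edge Laplacian.  For the same reason its
   eigenfunctions depend on the first edge only, and reversing the edges makes
   them eigenfunctions of the edge Laplacian. *)

(** * Rays and ends of trees *)

Section ReducedWalks.
Variable G : graph.
Implicit Types (w v : nat -> G) (r : ray G).

Definition reduced_walk w n : Prop :=
  (forall i, (i < n)%N -> edge (w i) (w i.+1)) /\
  (forall i, (i.+1 < n)%N -> w i.+2 <> w i).

Lemma ray_eqP r r' : (forall i, r i = r' i) -> r = r'.
Proof.
case: r r' => [f fP] [g gP] /= /funext fg.
by move: gP; rewrite -fg => gP; congr Ray; exact: Prop_irrelevance.
Qed.

Lemma ray_walk r k n : reduced_walk (fun i => r (k + i)%N) n.
Proof. by split=> i _; rewrite !addnS; case: (rayP r (k + i)). Qed.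

Lemma reduced_walk_le w n m : (m <= n)%N -> reduced_walk w n -> reduced_walk w m.
Proof. by move=> mn [we wn]; split=> i im; [apply: we|apply: wn]; lia. Qed.

Lemma reduced_walk_shift w n : reduced_walk w n.+1 ->
  reduced_walk (fun i => w i.+1) n.
Proof. by move=> [we wn]; split=> i im; [apply: we|apply: wn]; lia. Qed.

Lemma shift_rayP r k i :
  edge (r (k + i)%N) (r (k + i.+1)%N) /\ r (k + i.+2)%N <> r (k + i)%N.
Proof. by rewrite !addnS; exact: rayP. Qed.
Definition shift_ray r k : ray G :=
  Ray (rvertex := fun i => r (k + i)%N) (shift_rayP r k).

(** Equality of tails up to a shift of the index. In a tree this is the same as sharing infinitely
    many vertices ([ray_classE]), and it is the form in which ends are handled below. *)
Definition cofinal r r' : Prop :=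
  exists k l, forall i, r (k + i)%N = r' (l + i)%N.

Lemma cofinal_refl r : cofinal r r.
Proof. by exists 0, 0. Qed.

Lemma cofinal_sym r r' : cofinal r r' -> cofinal r' r.
Proof. by move=> [k [l rr]]; exists l, k. Qed.

Lemma cofinal_trans r2 r1 r3 : cofinal r1 r2 -> cofinal r2 r3 -> cofinal r1 r3.
Proof.
move=> [k [l r12]] [l' [m r23]]; exists (k + l')%N, (m + l)%N => i.
by rewrite -addnA r12 -addnA -r23; congr (r2 _); lia.
Qed.

Lemma cofinal_shift r k : cofinal (shift_ray r k) r.
Proof. by exists 0, k. Qed.

End ReducedWalks.

Section TreeWalks.
Variable T : tree.
Implicit Types (w v : nat -> T) (r : ray T) (x y o : T).

Lemma walk_closed w n : reduced_walk w n -> w n = w 0%N -> n = 0%N.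
Proof.
move=> [we wn] wn0; case: n we wn wn0 => // n we wn.
by have [_ /(_ w n.+1)] := tree_sc T; move=> /(_ isT we wn).
Qed.

(* If the first steps differ, the concatenation of one walk reversed with the
   other is a closed reduced walk. *)
Lemma walk_uniq w v n m : reduced_walk w n -> reduced_walk v m ->
  w 0%N = v 0%N -> w n = v m -> n = m /\ forall i, (i <= n)%N -> w i = v i.
Proof.
elim: n w v m => [|n IHn] w v m rw rv w0 wn.
  have m0 : m = 0%N by apply: walk_closed rv _; rewrite -w0 wn.
  by split=> // i; rewrite leqn0 => /eqP ->.
case: m rv wn => [|m] rv wn.
  by have := walk_closed rw; rewrite wn w0 => /(_ erefl).
have [wv1|wv1] := EM (w 1%N = v 1%N).
  have [nm wvi] := IHn _ _ _ (reduced_walk_shift rw) (reduced_walk_shift rv) wv1 wn.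
  split; first by rewrite nm.
  by move=> [|i] // ilt; exact: wvi.
pose c i := if (i <= n.+1)%N then w (n.+1 - i)%N else v (i - n.+1)%N.
have cl i : (i <= n.+1)%N -> c i = w (n.+1 - i)%N by rewrite /c => ->.
have cr i : c (n.+1 + i)%N = v i.
  rewrite /c; case: ifPn => h; last by congr v; lia.
  by have -> : i = 0%N; [lia|rewrite addn0 subnn].
suff /walk_closed : reduced_walk c (n.+1 + m.+1).
  by rewrite cr cl// subn0 wn => /(_ erefl); lia.
case: rw rv => [we wb] [ve vb]; split=> i ilt.
  have [lt|ge] := ltnP i n.+1.
    rewrite !cl//; last by lia.
    rewrite edge_sym; have -> : (n.+1 - i = (n.+1 - i.+1).+1)%N by lia.
    by apply: we; lia.
  have -> : i = (n.+1 + (i - n.+1))%N by lia.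
  by rewrite -addnS !cr; apply: ve; lia.
have [lt|ge] := ltnP i.+1 n.+1.
  rewrite !cl//; [|lia..].
  have -> : (n.+1 - i = (n.+1 - i.+2).+2)%N by lia.
  by apply/nesym; apply: wb; lia.
(* At [i = n] the walk turns from [w] reversed to [v]; there, being reduced is the assumption
   [w 1 <> v 1]. *)
have [ee|ne] := eqVneq i n.
  rewrite ee (cl n)//; have -> : (n.+2 = n.+1 + 1)%N by lia.
  by rewrite cr subSn// subnn; exact/nesym.
have -> : i = (n.+1 + (i - n.+1))%N by lia.
by rewrite -!addnS !cr; apply: vb; lia.
Qed.

Lemma ray_prefix r r' i j : r 0%N = r' 0%N -> r i = r' j ->
  i = j /\ forall k, (k <= i)%N -> r k = r' k.
Proof.
move=> r0 rij.
exact: walk_uniq (ray_walk r 0 i) (ray_walk r' 0 j) r0 rij.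
Qed.

Lemma ray_unique r r' : r 0%N = r' 0%N -> cofinal r r' -> r = r'.
Proof.
move=> r0 [k [l rr]]; apply: ray_eqP => i.
have [_] := ray_prefix r0 (rr i); apply; lia.
Qed.

Lemma infinite_unbounded (A : set nat) n : infinite_set A ->
  exists2 i, A i & (n <= i)%N.
Proof.
move=> Ainf; apply: contrapT => h; apply: Ainf.
apply: (@sub_finite_set _ _ `I_n); last exact: finite_II.
by move=> i Ai /=; rewrite ltnNge; apply/negP => ni; apply: h; exists i.
Qed.

(** Only finitely many common vertices can come early on either ray, so there is one far beyond
    [r k = r' l] on both. Uniqueness of reduced walks then identifies the segments up to it. *)
Lemma common_tail r r' k l : r k = r' l ->
  infinite_set (range r `&` range r') -> forall i, r (k + i)%N = r' (l + i)%N.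
Proof.
move=> rkl inf i.
pose A := [set m | exists2 j, r m = r' j & (l <= j)%N].
have : infinite_set A.
  move=> Afin; apply: inf.
  apply: (@sub_finite_set _ _ (r @` A `|` r' @` `I_l)); last first.
    rewrite finite_setU; split; apply: finite_image => //; exact: finite_II.
  move=> _ [[m _ <-] [j _ jm]]; have [lj|jl] := leqP l j; last by right; exists j.
  by left; exists m => //; exists j.
move=> /(infinite_unbounded (k + i)) [m [j mj lj] kim].
have := @ray_prefix (shift_ray r k) (shift_ray r' l) (m - k) (j - l).
rewrite /= !addn0 !subnKC//; last lia.
by move=> /(_ rkl mj) [_]; apply; lia.
Qed.

Lemma cofinal_infinite r r' : cofinal r r' ->
  infinite_set (range r `&` range r').
Proof.
move=> [k [l rr]].
apply: (@sub_infinite_set _ [set r (k + i)%N | i in [set: nat]]).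
  by move=> _ [i _ <-]; split; [exists (k + i)%N|exists (l + i)%N].
have inj : {in [set: nat] &, injective (fun i => r (k + i)%N)}.
  by move=> i j _ _ /ray_inj/addnI.
by rewrite (eq_finite_set (inj_card_eq inj)); exact: infinite_nat.
Qed.

Lemma ray_classE r r' : ray_class r r' <-> cofinal r r'.
Proof.
split=> [inf|]; last exact: cofinal_infinite.
have [_ [[k _ <-] [l _ rlk]]] := infinite_setN0 inf.
by exists k, l; exact: common_tail.
Qed.

Lemma bclassP r r' : bclass r = bclass r' <-> cofinal r r'.
Proof.
split=> [/(congr1 val)/= rr|rr].
  by apply/ray_classE; rewrite rr; apply/ray_classE; exact: cofinal_refl.
apply: val_inj => /=; apply/seteqP; split=> q /ray_classE rq; apply/ray_classE.
  exact: cofinal_trans (cofinal_sym rr) rq.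
exact: cofinal_trans rr rq.
Qed.

Lemma ray_from0 x (w : boundary T) : ray_from x w 0%N = x.
Proof. by rewrite /ray_from; case: cid => r []. Qed.

Lemma bclass_ray_from x (w : boundary T) : bclass (ray_from x w) = w.
Proof.
rewrite /ray_from; case: cid => r [/= wr _].
have [q wq] := brep_subproof w.
move: wr; rewrite wq /= => /ray_classE qr; apply/bclassP; exact: cofinal_sym.
Qed.

Lemma ray_from_bclass r : ray_from (r 0%N) (bclass r) = r.
Proof.
apply: ray_unique; first by rewrite ray_from0.
by apply/bclassP; rewrite bclass_ray_from.
Qed.

Lemma ray_from_shift x (w : boundary T) k :
  ray_from (ray_from x w k) w = shift_ray (ray_from x w) k.
Proof.
set r := ray_from x w.
have <- : bclass (shift_ray r k) = w.
  by rewrite -[RHS](bclass_ray_from x w); apply/bclassP/cofinal_shift.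
by have := ray_from_bclass (shift_ray r k); rewrite /= addn0.
Qed.

Lemma ray_from_tail x y (w : boundary T) k l : ray_from x w k = ray_from y w l ->
  forall i, ray_from x w (k + i)%N = ray_from y w (l + i)%N.
Proof.
move=> kl i.
by have := congr1 (fun r : ray T => r i) (ray_from_shift x w k);
   rewrite kl ray_from_shift /= => ->.
Qed.

Lemma ray_from_cofinal x y (w : boundary T) :
  cofinal (ray_from x w) (ray_from y w).
Proof. by apply/bclassP; rewrite !bclass_ray_from. Qed.

Lemma ray_consP x r : edge x (r 0%N) -> r 1%N <> x -> forall i,
  let f i := if i is j.+1 then r j else x in
  edge (f i) (f i.+1) /\ f i.+2 <> f i.
Proof. by move=> xr r1 [|i] //=; exact: rayP. Qed.

(** If the ray from [y] avoids [x] at its first step, prefixing [x] to it gives a ray to the same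
    end, which by uniqueness is the ray from [x]. *)
Lemma ray_from_edge x y (w : boundary T) : edge x y ->
  (ray_from x w 1%N = y) \/ (ray_from y w 1%N = x).
Proof.
move=> xy; have [|yx] := EM (ray_from y w 1%N = x); first by right.
left; set r := ray_from y w in yx *.
have xr : edge x (r 0%N) by rewrite ray_from0.
pose q := Ray (ray_consP xr yx).
have qw : bclass q = w.
  rewrite -(bclass_ray_from y w); apply/bclassP; exists 1%N, 0%N => i //=.
have := ray_from_bclass q; rewrite qw /= => ->; exact: ray_from0.
Qed.

Lemma ray_from_step x (w : boundary T) : ray_from (ray_from x w 1%N) w 1%N <> x.
Proof.
rewrite ray_from_shift /= -[X in _ <> X](ray_from0 x w).
by case: (rayP (ray_from x w) 0).
Qed.

(** Induction along [r]: otherwise the ray from [r 1] to [w] would step back to [r 0], whereas it is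
    known to go on to [r 2]. Hence one edge crossed towards [w] fixes the whole segment before
    it. *)
Lemma ray_from_prefix r i (w : boundary T) : ray_from (r i) w 1%N = r i.+1 ->
  forall j, (j <= i.+1)%N -> ray_from (r 0%N) w j = r j.
Proof.
elim: i r => [|i IHi] r ri.
  by move=> [|[|]]//; rewrite ray_from0.
have := IHi (shift_ray r 1) ri; rewrite /= => {}IHi.
have r1 : ray_from (r 0%N) w 1%N = r 1%N.
  have e01 : edge (r 0%N) (r 1%N) by case: (rayP r 0).
  case: (ray_from_edge w e01) => //.
  by move: (IHi 1%N isT); rewrite /= !add1n => -> /(proj2 (rayP r 0)).
move=> [|j] jlt; first by rewrite ray_from0.
have := IHi j jlt; rewrite /= !add1n => <-.
by rewrite -{1}r1 ray_from_shift.
Qed.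

End TreeWalks.

Section WalkExistence.
Variable G : graph.
Implicit Types (w : nat -> G) (x y : G).

(** Putting a vertex in front of a reduced walk either keeps it reduced or cancels its first
    step. *)
Lemma path_reduced x s : path (@edge G) x s -> exists w n,
  [/\ reduced_walk w n, w 0%N = x, w n = last x s & (n <= size s)%N].
Proof.
elim: s x => [|y s IHs] x /=; first by move=> _; exists (fun=> x), 0%N.
move=> /andP[xy /IHs[w [n [rw w0 wn ns]]]].
have [[n0 w1]|back] := EM ((0 < n)%N /\ w 1%N = x).
  case: n n0 rw wn ns => // n _ rw wn ns.
  exists (fun i => w i.+1), n; split=> //; last lia.
  exact: reduced_walk_shift.
exists (fun i => if i is j.+1 then w j else x), n.+1; split=> //.
case: rw => we wb; split=> -[|i] ilt //=; first by rewrite w0.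
- exact: we.
- by move=> w1; apply: back; split=> //; lia.
- exact: wb.
Qed.

Lemma ray_path (r : ray G) k : exists s,
  [/\ path (@edge G) (r 0%N) s, last (r 0%N) s = r k & size s = k].
Proof.
elim: k => [|k [s [ps ls ss]]]; first by exists [::].
exists (rcons s (r k.+1)); rewrite rcons_path last_rcons size_rcons ps ls ss.
by split=> //; case: (rayP r k).
Qed.

End WalkExistence.

(** * Distances, confluence points and the horocycle bracket *)

Section Horocycles.
Variable T : tree.
Implicit Types (x y o : T) (r : ray T) (w : boundary T) (g : automorphism T).

Lemma reduced_walk_exists x y : exists v n,
  [/\ @reduced_walk T v n, v 0%N = x & v n = y].
Proof.
have [/(_ x y) [s ps ls] _] := tree_sc T.
by have [v [n [rv v0 vn _]]] := path_reduced ps; exists v, n; rewrite vn.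
Qed.

(** Any path to [r k] shortens to a reduced walk, and by uniqueness this is the initial segment of
    [r]. *)
Lemma tree_dist_ray r k : tree_dist (r 0%N) (r k) = k.
Proof.
rewrite /tree_dist; case: ex_minnP => n /asboolP[s [ps ls <-]] min.
apply/eqP; rewrite eqn_leq; apply/andP; split.
  by apply: min; apply/asboolP; exact: ray_path.
have [v [m [rv v0 vm ms]]] := path_reduced ps.
have rkv : r k = v m by rewrite vm ls.
by have [-> _] := walk_uniq (ray_walk r 0 k) rv (esym v0) rkv.
Qed.

Lemma ray_from_dist x w k : tree_dist x (ray_from x w k) = k.
Proof. by rewrite -{1}(ray_from0 x w) tree_dist_ray. Qed.

Lemma confluent_spec o x w : exists k l,
  [/\ confluent o x w = ray_from o w k, confluent o x w = ray_from x w l &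
      forall i, ray_from o w (k + i)%N = ray_from x w (l + i)%N].
Proof.
pose P y := range (ray_from o w) `&` range (ray_from x w) = range (ray_from y w).
suff Py : exists y, P y.
  have := xgetPex x Py; rewrite -/(confluent o x w).
  set y := confluent o x w; rewrite /P => PE.
  have : range (ray_from y w) y by exists 0%N => //; rewrite ray_from0.
  rewrite -PE => -[[k _ ky] [l _ ly]]; exists k, l; split=> //.
  by apply: ray_from_tail; rewrite ky ly.
(* The confluence point is the first vertex of the ray from [o] that lies on the ray from [x]; from
   there on the two rays coincide. *)
pose Q k := `[< exists l, ray_from o w k = ray_from x w l >].
have [k0 [l0 kl0]] := ray_from_cofinal o x w.
have exQ : exists k, Q k.
  by exists k0; apply/asboolP; exists l0; have := kl0 0%N; rewrite !addn0.
pose k := ex_minn exQ.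
have [/asboolP[l kl] min] : Q k /\ forall k', Q k' -> (k <= k')%N.
  by rewrite /k; case: ex_minnP.
exists (ray_from o w k); apply/seteqP; split=> [y [[i _ iy] [j _ jy]]|y [i _ <-]].
  have ki : (k <= i)%N by apply: min; apply/asboolP; exists j; rewrite iy jy.
  by exists (i - k)%N => //; rewrite ray_from_shift /= subnKC.
rewrite ray_from_shift /=; split; first by exists (k + i)%N.
by exists (l + i)%N => //; rewrite (ray_from_tail kl).
Qed.

(** Rays are injective, so any two ways of matching the tails have the same index difference. This
    frees later computations from [confluent]. *)
Lemma horo_bracketE o x w k l :
  (forall i, ray_from o w (k + i)%N = ray_from x w (l + i)%N) ->
  horo_bracket o x w = k%:Z - l%:Z.
Proof.
move=> kl; have [k' [l' [ck cl kl']]] := confluent_spec o x w.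
rewrite /horo_bracket {1}ck cl !ray_from_dist.
suff : (k' + l = k + l')%N by lia.
have [d|d] := leqP k k'.
  have := kl (k' - k)%N; rewrite subnKC// -[X in ray_from o w X]addn0 kl' => /ray_inj.
  lia.
have := kl' (k - k')%N; rewrite subnKC ?(ltnW d)// -[X in ray_from o w X]addn0 kl.
move=> /ray_inj; lia.
Qed.

Lemma horo_bracket_cocycle o x y w :
  horo_bracket o x w + horo_bracket x y w = horo_bracket o y w.
Proof.
have [k [l kl]] := ray_from_cofinal o x w.
have [k' [l' kl']] := ray_from_cofinal x y w.
rewrite (horo_bracketE kl) (horo_bracketE kl').
rewrite (@horo_bracketE o y w (k + k') (l' + l)); first by lia.
by move=> i; rewrite -!addnA kl -kl'; congr (ray_from x w _); lia.
Qed.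

Lemma horo_bracket_id o w : horo_bracket o o w = 0.
Proof. by rewrite (@horo_bracketE o o w 0 0). Qed.

Lemma horo_bracket_sym o x w : horo_bracket o x w = - horo_bracket x o w.
Proof.
apply/eqP; rewrite -subr_eq0 opprK horo_bracket_cocycle.
by rewrite horo_bracket_id.
Qed.

Lemma horo_bracket_step x y w : ray_from x w 1%N = y -> horo_bracket x y w = 1.
Proof.
move=> xy; rewrite (@horo_bracketE x y w 1 0)//.
by apply: ray_from_tail; rewrite xy ray_from0.
Qed.

Lemma ray_from_map g x w : ray_from (g x) (bmap g w) = ray_map g (ray_from x w).
Proof.
rewrite /bmap; case: cid => r /= wr.
have -> : bclass (ray_map g r) = bclass (ray_map g (ray_from x w)).
  have /bclassP[k [l rl]] : bclass r = bclass (ray_from x w).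
    by rewrite bclass_ray_from.
  by apply/bclassP; exists k, l => i /=; rewrite rl.
by have := ray_from_bclass (ray_map g (ray_from x w)); rewrite /= ray_from0.
Qed.

Lemma horo_bracket_map g o x w :
  horo_bracket (g o) (g x) (bmap g w) = horo_bracket o x w.
Proof.
have [k [l kl]] := ray_from_cofinal o x w; rewrite (horo_bracketE kl).
by apply: horo_bracketE => i; rewrite !ray_from_map /= kl.
Qed.

End Horocycles.

(** * Topology of chains and ends *)

Section Compactness.

Lemma compact_finite_image (X : topologicalType) (J : choiceType) (f : X -> J)
    (A : set X) :
  (forall x, \forall y \near x, f y = f x) -> compact A -> finite_set (f @` A).
Proof.
move=> lf /compact_near_coveringP cA.
(* The filter of sets that contain all supersets of some finite set. Compactness as a near-covering
   property, applied to it, yields one finite set catching all values of [f] on [A]. *)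
pose F : set_system (set J) := [set Q | exists2 S0, finite_set S0 &
  forall S, S0 `<=` S -> Q S].
have FF : Filter F.
  split=> [|P Q [S finS PS] [S' finS' QS']|P Q PQ [S finS PS]].
  - by exists set0.
  - exists (S `|` S'); first by rewrite finite_setU.
    by move=> U SU; split; [apply: PS|apply: QS'] => y Sy; apply: SU; [left|right].
  - by exists S => // U SU; exact/PQ/PS.
have [|S0 finS0 S0P] := cA _ F (fun S x => S (f x)) FF.
  move=> x _; exists ([set y | f y = f x], [set S | S (f x)]).
    by split; [exact: lf|exists [set f x] => // S; apply].
  by move=> [y S] /= [-> ].
by apply: sub_finite_set finS0 => _ [x Ax <-]; exact: S0P Ax.
Qed.

Lemma ultra_finite_fiber (X : Type) (J : choiceType) (F : set_system X)
    (f : X -> J) (V : set J) : UltraFilter F -> finite_set V ->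
  F (f @^-1` V) -> exists v, F (f @^-1` [set v]).
Proof.
move=> UF /finite_seqP[s ->]; elim: s => [|v s IHs] FV.
  suff : F set0 by move/filter_ex => [].
  by apply: filterS FV => x /=; rewrite in_nil.
have [Fv|Fnv] := in_ultra_setVsetC (f @^-1` [set v]) UF; first by exists v.
apply: IHs; apply: filterS (filterI FV Fnv) => x [] /=.
by rewrite in_cons => /predU1P[].
Qed.

End Compactness.

Section ChainTopology.
Variable H : graph.
Implicit Types c d : chain H.

Lemma chain_vertices c i : val (c i) = (src (c i), src (c i.+1)).
Proof. by have [<- _] := chainP c i; rewrite [LHS]surjective_pairing. Qed.

Lemma chain_src_inj c d : (forall i, src (c i) = src (d i)) -> c = d.
Proof.
move=> cd; have {cd} : cedge c = cedge d.
  by apply/funext => i; apply: val_inj; rewrite !chain_vertices !cd.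
case: c d => [f fP] [g gP] /= fg; move: gP; rewrite -fg => gP.
by congr Chain; exact: Prop_irrelevance.
Qed.

Lemma cylinder_vertices c d n : (forall i, (i <= n)%N -> src (d i) = src (c i)) ->
  cylinder c n d.
Proof.
by move=> dc i ilt; apply: val_inj; rewrite !chain_vertices !dc// ltnW.
Qed.

Lemma cylinder_src c d n i : cylinder c n d -> (i < n)%N -> src (d i) = src (c i).
Proof. by move=> cd /cd ->. Qed.

Lemma cylinder_tgt c d n i : cylinder c n.+1 d -> (i <= n.+1)%N ->
  src (d i) = src (c i).
Proof.
move=> cd; rewrite leq_eqVlt => /predU1P[->|ilt]; last by rewrite cd.
by have [<- _] := chainP c n; have [<- _] := chainP d n; rewrite cd.
Qed.

Lemma cylinder_le c d m n : (m <= n)%N -> cylinder c n d -> cylinder c m d.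
Proof. by move=> mn cd i im; apply: cd; lia. Qed.

Lemma cylinder_trans c d e n : cylinder c n d -> cylinder d n e -> cylinder c n e.
Proof. by move=> cd de i ilt; rewrite de// cd. Qed.

Lemma nbhs_chain c (U : set (chain H)) :
  nbhs c U <-> exists n, cylinder c n `<=` U.
Proof.
rewrite nbhsE; split=> [[V [Vop Vc] VU]|[n cU]].
  move: Vop Vc VU => -[D' D'cyl <-] [W D'W Wc] VU.
  have [a [n Wn]] := D'cyl _ D'W; exists n => d cd; apply: VU; exists W => //.
  by rewrite /= Wn in Wc *; apply: cylinder_trans Wc cd.
exists (cylinder c n) => //; split=> //.
by exists [set cylinder c n]; [move=> _ ->; exists c, n|rewrite bigcup_set1].
Qed.

Lemma open_chain (U : set (chain H)) :
  (forall c, U c -> exists n, cylinder c n `<=` U) -> open U.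
Proof. by move=> Uc; rewrite openE => c /Uc /nbhs_chain. Qed.

Lemma chain_ultra_cvg (F : set_system (chain H)) (f : nat -> H) :
  UltraFilter F -> (forall i, F [set c | src (c i) = f i]) ->
  exists2 c : chain H, (forall i, src (c i) = f i) & F --> c.
Proof.
move=> UF Ff.
have fP i : edge (f i) (f i.+1) /\ f i.+2 <> f i.
  have [c [[<- <-] <-]] := filter_ex (filterI (filterI (Ff i) (Ff i.+1)) (Ff i.+2)).
  exact: chain_ray_subproof.
pose c := ray_chain (Ray fP); exists c => // U /nbhs_chain[n cU].
apply: filterS cU _.
suff : F [set d | forall i, (i <= n)%N -> src (d i) = f i].
  by apply: filterS => d df; exact: cylinder_vertices.
elim: n => [|n IHn].
  by apply: filterS (Ff 0%N) => d d0 i; rewrite leqn0 => /eqP ->.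
apply: filterS (filterI IHn (Ff n.+1)) => d [dn dn1] i.
by rewrite leq_eqVlt => /predU1P[->//|]; exact: dn.
Qed.

(** An ultrafilter form of the König lemma: the [i]-th vertices lie in the finite set [V i], so an
    ultrafilter selects one vertex for each index, and it converges to the chain through these
    vertices. *)
Lemma chain_compact (S : set H) : finite_set S ->
  (forall x : H, finite_set [set y | edge x y]) ->
  compact [set c : chain H | S (src (c 0%N))].
Proof.
move=> finS finH; rewrite compact_ultra => F UF FS.
pose V := fix V i : set H :=
  if i is j.+1 then \bigcup_(x in V j) [set y | edge x y] else S.
have finV i : finite_set (V i) by elim: i => //= i IHi; exact: bigcup_finite.
have Fi i : exists v, F [set c | src (c i) = v].
  apply: (@ultra_finite_fiber _ _ F (fun c : chain H => src (c i)) (V i)) => //.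
  apply: filterS FS => c; elim: i => //= i IHi Sc; exists (src (c i)).
    exact: IHi.
  by have [] := chain_ray_subproof c i.
have [f fF] := choice Fi.
have [c cf Fc] := chain_ultra_cvg UF fF; exists c; split=> //=.
by have [d [/= + Sd]] := filter_ex (filterI (fF 0%N) FS); rewrite cf => <-.
Qed.

Variable K : fieldType.
Implicit Types F : chain H -> K^o.

Lemma lc_chainP F : locally_constant F <->
  forall c, exists n, forall d, cylinder c n d -> F d = F c.
Proof.
split=> lF c; first by have /nbhs_chain[n nF] := lF c; exists n.
by have [n nF] := lF c; apply/nbhs_chain; exists n.
Qed.

Lemma lc_uniform F (A : set (chain H)) : compact A -> locally_constant F ->
  exists n, forall c d, A c -> cylinder c n d -> F d = F c.
Proof.
move=> /compact_near_coveringP cA /lc_chainP lF.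
(* The near-covering property along [\oo] turns the local depths into a common one. *)
have [|n _ nF] := cA _ \oo (fun n c => forall d, cylinder c n d -> F d = F c) _.
  move=> x _; have [n nF] := lF x.
  exists (cylinder x n, [set m | (n <= m)%N]).
    by split; [apply/nbhs_chain; exists n|exists n].
  move=> [c m] /= [xc nm] d cd; rewrite (nF c)// nF//.
  exact: cylinder_trans xc (cylinder_le nm cd).
by exists n => c d Ac; apply: nF Ac _ => /=.
Qed.

End ChainTopology.

Section BoundaryTopology.
Variable T : tree.
Implicit Types (x y o : T) (w : boundary T) (g : automorphism T).

(** The rays from [x] and [y] to [w] merge. An end that follows [w] from [x] past the merging point
    leaves a vertex of the ray from [y] in the direction of [w], and [ray_from_prefix] propagates
    this back to [y]. *)
Lemma ray_from_transfer x y w n : exists m, forall w',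
  (forall i, (i <= m)%N -> ray_from x w' i = ray_from x w i) ->
  forall i, (i <= n)%N -> ray_from y w' i = ray_from y w i.
Proof.
have [k [l kl]] := ray_from_cofinal y x w.
exists (l + n).+1 => w' ww' i ilt.
have := @ray_from_prefix T (ray_from y w) (k + n) w'; rewrite ray_from0.
rewrite kl -ww'// ray_from_shift /= addn1 ww'// -addnS -kl addnS.
by move=> /(_ erefl); apply; lia.
Qed.

(** Finitely many subbasic sets, given by edges anywhere in the tree, are compared with segments
    from [x] by [ray_from_transfer]. Conversely, agreeing with [w] up to depth [n] follows from
    membership in the single set [bd_plus] of the [n]-th edge towards [w]. *)
Lemma nbhs_boundary x w (U : set (boundary T)) : nbhs w U <->
  exists n, forall w', (forall i, (i <= n)%N -> ray_from x w' i = ray_from x w i) ->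
    U w'.
Proof.
rewrite nbhsE; split=> [[V [Vop Vw] VU]|[n wU]].
  move: Vop Vw VU => -[D' D'fin <-] [W D'W Ww] VU.
  have [S Ssub WE] := D'fin _ D'W.
  suff [n nW] : exists n, forall w',
      (forall i, (i <= n)%N -> ray_from x w' i = ray_from x w i) ->
      forall B, B \in enum_fset S -> B w'.
    exists n => w' /nW h; apply: VU; exists W => //=.
    have : (\bigcap_(B in [set` S]) B) w' by move=> B BS; exact: h.
    by rewrite -WE.
  move: Ww; rewrite -WE => {}WE.
  have : forall B, B \in enum_fset S -> range (@bd_plus T) B /\ B w.
    by move=> B BS; split; [have := Ssub _ BS; rewrite inE|exact: WE].
  elim: (enum_fset S) => [|B s IHs] sP; first by exists 0%N.
  have [|n nP] := IHs; first by move=> C Cs; apply: sP; rewrite inE Cs orbT.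
  have [[e _ eB] Bw] := sP B (mem_head _ _).
  have [m mP] := ray_from_transfer x (src e) w 1.
  exists (maxn m n) => w' ww' C; rewrite inE => /predU1P[->|]; last first.
    by apply: nP => i ilt; apply: ww'; lia.
  move: Bw; rewrite -eB /bd_plus /= => <-; apply: mP => // i ilt.
  by apply: ww'; lia.
pose r := ray_from x w.
pose e : dedge T := exist _ (r n, r n.+1) (proj1 (rayP r n)).
exists (bd_plus e); last first.
  move=> w'; rewrite /bd_plus /src /tgt /= => we; apply: wU => i ilt.
  by rewrite -{1}(ray_from0 x w) (ray_from_prefix we)//; lia.
split; last by rewrite /bd_plus /src /tgt /= ray_from_shift /= addn1.
exists [set bd_plus e]; last by rewrite bigcup_set1.
move=> _ ->; exists [fset (bd_plus e : set (boundary T))]%fset.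
  by move=> B /fset1P ->; rewrite inE; exists e.
apply/seteqP; split=> [v ev|v ev B /= BS].
  by apply: (ev (bd_plus e)); rewrite /= inE.
by move/fset1P: BS => ->.
Qed.

Lemma near_ray_from x w n : \forall w' \near w,
  forall i, (i <= n)%N -> ray_from x w' i = ray_from x w i.
Proof. by apply/(nbhs_boundary x); exists n. Qed.

Lemma near_chain_from x w n :
  \forall w' \near w, cylinder (chain_from x w) n (chain_from x w').
Proof.
apply: filterS (near_ray_from x w n) => w' ww'.
exact: cylinder_vertices.
Qed.

Lemma near_horo_bracket o x w :
  \forall w' \near w, horo_bracket o x w' = horo_bracket o x w.
Proof.
have [k [l kl]] := ray_from_cofinal o x w; rewrite (horo_bracketE kl).
near=> w'; apply: horo_bracketE; apply: ray_from_tail.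
have -> : ray_from o w' k = ray_from o w k by near: w';
  apply: filterS (near_ray_from o w k) => w' /(_ _ (leqnn k)).
have -> : ray_from x w' l = ray_from x w l by near: w';
  apply: filterS (near_ray_from x w l) => w' /(_ _ (leqnn l)).
by have := kl 0%N; rewrite !addn0.
Unshelve. all: by end_near. Qed.

Lemma bmap_cvg g w : bmap g w' @[w' --> w] --> bmap g w.
Proof.
have [r _] := brep_subproof w; pose x := r 0%N.
move=> U /(nbhs_boundary (g x))[n nU]; apply/(nbhs_boundary x); exists n => w' ww'.
by apply: nU => i ilt; rewrite !ray_from_map /= ww'.
Qed.

Lemma chain_from0 x w : src (chain_from x w 0%N) = x.
Proof. exact: ray_from0. Qed.

Lemma chain_from_src x w i : src (chain_from x w i) = ray_from x w i.
Proof. by []. Qed.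

Lemma endpointK (c : chain T) : chain_from (src (c 0%N)) (endpoint c) = c.
Proof.
apply: chain_src_inj => i; rewrite chain_from_src /endpoint.
by rewrite (ray_from_bclass (chain_ray c)).
Qed.

Lemma chain_fromK x w : endpoint (chain_from x w) = w.
Proof.
by rewrite -[RHS](bclass_ray_from x w); congr bclass; exact: ray_eqP.
Qed.

Lemma bd_plusE e w : bd_plus e w <-> chain_from (src e) w 0%N = e.
Proof.
rewrite /bd_plus /=; split=> [we|/(congr1 (@tgt T))//].
apply: val_inj => /=; rewrite we ray_from0.
by rewrite /src /tgt -surjective_pairing.
Qed.

Lemma bd_plus_op e w : bd_plus (edge_op e) w <-> ~ bd_plus e w.
Proof.
rewrite /bd_plus /=; split=> [op we|nwe].
  have := @ray_from_step T (src e) w; rewrite we; exact.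
by have [] := ray_from_edge w (valP e).
Qed.

Lemma chain_shift_from e w : bd_plus e w ->
  chain_shift (chain_from (src e) w) = chain_from (tgt e) w.
Proof.
move=> we; apply: chain_src_inj => i.
rewrite [LHS](_ : _ = ray_from (src e) w i.+1)// chain_from_src.
by have <- : ray_from (src e) w 1%N = tgt e := we; rewrite ray_from_shift.
Qed.

End BoundaryTopology.

(** * Lifts and deck transformations *)

Section CoveringLifts.
Variables (H G : graph) (p : covering H G).
Implicit Types (x y : H) (v : nat -> H) (w : nat -> G).

Lemma cov_local_inj x y y' : edge x y -> edge x y' -> p y = p y' -> y = y'.
Proof.
by move=> xy xy'; have [_ inj _] := cov_bij p x; apply: inj; rewrite inE.
Qed.

Lemma cov_local_surj x b : edge (p x) b -> exists2 y, edge x y & p y = b.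
Proof. by have [_ _ surj] := cov_bij p x; move=> /surj[y]; exists y. Qed.

(** One sequence [v] serves for every [n]: it is continued by the default of [xget] where [w] ceases
    to be a walk, so both finite walks and infinite chains can be lifted. *)
Lemma walk_lift w x : p x = w 0%N -> exists v, v 0%N = x /\
  forall n, (forall i, (i < n)%N -> edge (w i) (w i.+1)) ->
    (forall i, (i <= n)%N -> p (v i) = w i) /\
    (forall i, (i < n)%N -> edge (v i) (v i.+1)).
Proof.
move=> px.
pose v := fix v i := if i is j.+1
  then xget x [set y | edge (v j) y /\ p y = w j.+1] else x.
exists v; split=> // n we.
have vP i : p (v i) = w i -> edge (w i) (w i.+1) ->
    edge (v i) (v i.+1) /\ p (v i.+1) = w i.+1.
  move=> pv wi; have [y vy py] : exists2 y, edge (v i) y & p y = w i.+1.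
    by apply: cov_local_surj; rewrite pv.
  by have := @xgetPex _ x [set y | edge (v i) y /\ p y = w i.+1]; apply; exists y.
have pv i : (i <= n)%N -> p (v i) = w i.
  elim: i => [//|i IHi] ilt; have [//||//] := vP i; first by apply: IHi; lia.
  exact: we.
by split=> // i ilt; have [|//|//] := vP i; [apply: pv; lia|exact: we].
Qed.

Lemma walk_lift_uniq v v' n : v 0%N = v' 0%N ->
  (forall i, (i < n)%N -> edge (v i) (v i.+1)) ->
  (forall i, (i < n)%N -> edge (v' i) (v' i.+1)) ->
  (forall i, (i <= n)%N -> p (v i) = p (v' i)) ->
  forall i, (i <= n)%N -> v i = v' i.
Proof.
move=> v0 ve ve' pvv'; elim=> // i IHi ilt; have vi := IHi (ltnW ilt).
apply: (@cov_local_inj (v i)); [exact: ve|rewrite vi; exact: ve'|exact: pvv'].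
Qed.

Lemma cmap_src (c : chain H) i : src (cmap p c i) = p (src (c i)).
Proof. by []. Qed.

Lemma chain_lift (c : chain G) x : p x = src (c 0%N) ->
  exists2 d : chain H, src (d 0%N) = x & cmap p d = c.
Proof.
move=> px; have [v [v0 vP]] := @walk_lift (fun i => src (c i)) x px.
have ce i : edge (src (c i)) (src (c i.+1)) by case: (chain_ray_subproof c i).
have pv i : p (v i) = src (c i) by have [->] := vP i (fun j _ => ce j).
have rP i : edge (v i) (v i.+1) /\ v i.+2 <> v i.
  split; first by have [_ ->] := vP i.+1 (fun j _ => ce j).
  by case: (chain_ray_subproof c i) => _ + /(congr1 p); rewrite !pv.
exists (ray_chain (Ray rP)) => //; apply: chain_src_inj => i.
by rewrite cmap_src [src _](_ : _ = v i)// pv.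
Qed.

Lemma cylinder_cmap (c d : chain H) n :
  cylinder c n d -> cylinder (cmap p c) n (cmap p d).
Proof. by move=> cd i /cd e; rewrite /= e. Qed.

Lemma cylinder_cmap_inj (c d : chain H) n : src (c 0%N) = src (d 0%N) ->
  cylinder (cmap p c) n (cmap p d) -> cylinder c n d.
Proof.
case: n => // n cd0 cd; apply: cylinder_vertices => i ilt.
apply: (@walk_lift_uniq (fun i => src (d i)) (fun i => src (c i)) n.+1) => //.
- by move=> j _; case: (chain_ray_subproof d j).
- by move=> j _; case: (chain_ray_subproof c j).
- move=> j jlt; exact: cylinder_tgt cd jlt.
Qed.

Lemma cmap_inj (c d : chain H) : src (c 0%N) = src (d 0%N) ->
  cmap p c = cmap p d -> c = d.
Proof.
move=> cd0 cd; apply: chain_src_inj => i; apply/esym.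
have cdi : cylinder c i.+1 d by apply: cylinder_cmap_inj => //; rewrite cd.
exact: cylinder_tgt cdi (leqnSn i).
Qed.

Lemma cov_surj x (a : G) : connected_graph G -> exists y, p y = a.
Proof.
move=> /(_ (p x) a)[s]; elim: s x => [|b s IHs] x /=; first by exists x.
by move=> /andP[/cov_local_surj[y _ <-]]; exact: IHs.
Qed.

Lemma emap_surj x (e : dedge G) : connected_graph G ->
  exists2 d, emap p d = e & True.
Proof.
move=> /(@cov_surj x (src e))[y py].
have [y' yy' py'] : exists2 y', edge y y' & p y' = tgt e.
  by apply: cov_local_surj; rewrite py; exact: (valP e).
exists (exist _ (y, y') yy') => //; apply: val_inj => /=.
by rewrite py py' -surjective_pairing.
Qed.

Lemma finite_neighbours : (forall a : G, finite_set [set b | edge a b]) ->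
  forall x, finite_set [set y | edge x y].
Proof.
move=> finG x; have [pf inj _] := cov_bij p x.
rewrite -(eq_finite_set (inj_card_eq inj)).
by apply: sub_finite_set (finG (p x)) => _ [y xy <-]; exact: pf.
Qed.

End CoveringLifts.

Section DeckTransformations.
Variables (T : tree) (G : graph) (p : covering T G).
Implicit Types (x y : T) (g h : automorphism T).

(* [v'] is the end of the lift at [y] of the projection of the reduced walk from
   [x] to [v]. *)
Definition transported x y (v v' : T) : Prop := exists a b n,
  [/\ reduced_walk a n, reduced_walk b n, a 0%N = x /\ b 0%N = y,
      a n = v /\ b n = v' & forall i, (i <= n)%N -> p (a i) = p (b i)].

(** A backtracking of [b] would give two neighbours of [a i.+1] with the same projection, hence a
    backtracking of [a]. *)
Lemma reduced_walk_cov (a b : nat -> T) n : reduced_walk a n ->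
  (forall i, (i < n)%N -> edge (b i) (b i.+1)) ->
  (forall i, (i <= n)%N -> p (a i) = p (b i)) -> reduced_walk b n.
Proof.
move=> [ae ab] be pab; split=> // i ilt bi; apply: (ab i) => //.
apply: (@cov_local_inj _ _ p (a i.+1)).
- by apply: ae; lia.
- by rewrite edge_sym; apply: ae; lia.
- by rewrite !pab ?bi//; lia.
Qed.

Lemma transported_exists x y v : p x = p y -> exists v', transported x y v v'.
Proof.
move=> pxy; have [a [n [ra a0 an]]] := reduced_walk_exists x v.
have [b [b0 bP]] := @walk_lift _ _ p (fun i => p (a i)) y
  (etrans (esym pxy) (congr1 p (esym a0))).
have [pb be] := bP n (fun i ilt => cov_edge p (ra.1 i ilt)).
exists (b n), a, b, n; split=> //; last by move=> i /pb ->.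
by apply: reduced_walk_cov ra be _ => i /pb ->.
Qed.

Lemma transported_sym x y v v' : transported x y v v' -> transported y x v' v.
Proof.
move=> [a [b [n [ra rb [a0 b0] [an bn] pab]]]]; exists b, a, n; split=> //.
by move=> i /pab ->.
Qed.

Lemma transported_fun x y v v1 v2 :
  transported x y v v1 -> transported x y v v2 -> v1 = v2.
Proof.
move=> [a [b [n [ra rb [a0 b0] [an <-] pab]]]].
move=> [a' [b' [n' [ra' rb' [a0' b0'] [an' <-] pab']]]].
have [] := walk_uniq ra ra' _ _; [by rewrite a0 a0'|by rewrite an an'|].
move=> nn aa; rewrite -nn in ra' rb' pab' *.
apply: (@walk_lift_uniq _ _ p b b' n) => //.
- by rewrite b0 b0'.
- exact: rb.1.
- exact: rb'.1.
- by move=> i ilt; rewrite -pab// aa// pab'.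
Qed.

(** The walk to [u] is the walk to [v], either cut by one step, when [u] is its last vertex but one,
    or extended by one step. The transported walk is modified in the same way. *)
Lemma transported_edge x y v v' u u' :
  transported x y v v' -> transported x y u u' -> edge v u -> edge v' u'.
Proof.
move=> [a [b [n [ra rb [a0 b0] [an bn] pab]]]] uu' vu.
have [[n0 ua]|back] := EM ((0 < n)%N /\ u = a n.-1).
  have /(transported_fun uu') -> : transported x y u (b n.-1).
    exists a, b, n.-1; split=> //; try exact: reduced_walk_le (leq_pred n) _.
    by move=> i ilt; apply: pab; lia.
  by rewrite edge_sym -bn -[in X in edge _ X](prednK n0); apply: rb.1; lia.
have [u'' vu'' pu''] : exists2 u'', edge v' u'' & p u'' = p u.
  by apply: cov_local_surj; rewrite -bn -pab// an; exact: cov_edge.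
suff tr : transported x y u u'' by rewrite (transported_fun uu' tr).
pose ext (f : nat -> T) (s : T) i := if (i <= n)%N then f i else s.
have ext_le f s i : (i <= n)%N -> ext f s i = f i by rewrite /ext => ->.
have ext_gt f s : ext f s n.+1 = s by rewrite /ext ltnn.
have extE f s : reduced_walk f n -> edge (f n) s -> forall i, (i < n.+1)%N ->
    edge (ext f s i) (ext f s i.+1).
  move=> rf fs i; rewrite ltnS leq_eqVlt => /predU1P[->|ilt].
    by rewrite ext_gt ext_le.
  by rewrite !ext_le//; [apply: rf.1|lia].
have pext i : (i <= n.+1)%N -> p (ext a u i) = p (ext b u'' i).
  rewrite leq_eqVlt => /predU1P[->|ilt]; first by rewrite !ext_gt.
  by rewrite !ext_le// pab.
have ra' : reduced_walk (ext a u) n.+1.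
  split=> [|i]; first by apply: extE; rewrite ?an.
  rewrite ltnS leq_eqVlt => /predU1P[iE|ilt].
    rewrite iE ext_gt ext_le; last lia.
    by move=> uai; apply: back; rewrite -iE.
  by rewrite !ext_le//; [apply: ra.2|lia..].
exists (ext a u), (ext b u''), n.+1; split=> //.
by apply: reduced_walk_cov ra' _ pext; apply: extE; rewrite ?bn.
Qed.

(** Transport along reduced walks from [x] to walks from [y] is a map on vertices, since [T] is
    simply connected; transport from [y] to [x] is its inverse, and both preserve edges. *)
Lemma deck_transitive x y : p x = p y -> exists2 g, deck p g & g x = y.
Proof.
move=> pxy.
have [f fP] := choice (fun v => transported_exists v pxy).
have [f' f'P] := choice (fun v => transported_exists v (esym pxy)).
have fK : cancel f f'.
  by move=> v; apply: transported_fun (f'P _) (transported_sym (fP v)).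
have f'K : cancel f' f.
  by move=> v; apply: transported_fun (fP _) (transported_sym (f'P v)).
have fE u v : edge (f u) (f v) = edge u v.
  apply/idP/idP; last exact: transported_edge (fP u) (fP v).
  by apply: transported_edge (transported_sym (fP u)) (transported_sym (fP v)).
exists (MkAut fK f'K fE) => /=.
  by move=> v /=; have [a [b [n [_ _ _ [<- <-] /(_ _ (leqnn n)) ->]]]] := fP v.
apply: transported_fun (fP x) _.
by exists (fun=> x), (fun=> y), 0%N; split=> //; split.
Qed.

Lemma aut_eq g h : (forall x, g x = h x) -> g = h.
Proof.
case: g h => [f f' fK f'K fE] [k k' kK k'K kE] /= fk.
have {}fk : f = k by exact/funext.
have f'k' : f' = k' by apply/funext => x; rewrite -[x in f' x]k'K -fk fK.
by move: fK f'K fE kK k'K kE; rewrite fk f'k' => *; congr MkAut;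
  exact: Prop_irrelevance.
Qed.

(** Two lifts of the same map that agree at a vertex agree at its neighbours, and [T] is
    connected. *)
Lemma deck_free g h x : deck p g -> deck p h -> g x = h x -> g = h.
Proof.
move=> dg dh gh; apply: aut_eq => y.
have [/(_ x y)[s ps <-] _] := tree_sc T.
elim: s x gh ps => //= z s IHs x gh /andP[xz zs]; apply: IHs => //.
apply: (@cov_local_inj _ _ p (g x)); first exact: cov_edge.
  by have := cov_edge h xz; rewrite /= -gh.
by have := dg z; have := dh z; move=> /= -> ->.
Qed.

Lemma deck_inv g : deck p g -> deck p (aut_inv g).
Proof. by move=> dg x; have := dg (aut_inv g x); rewrite /= aut_invK => ->. Qed.

Lemma cmap_deck g (c : chain T) : deck p g -> cmap p (cmap g c) = cmap p c.
Proof. by move=> dg; apply: chain_src_inj => i; rewrite !cmap_src dg. Qed.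

Lemma emap_deck g (e : dedge T) : deck p g -> emap p (emap g e) = emap p e.
Proof. by move=> dg; apply: val_inj => /=; rewrite /src /tgt /= !dg. Qed.

End DeckTransformations.

(** * Dual spaces and locally constant functions *)

Section LinearIsos.
Variable K : fieldType.

Lemma linear_iso_inv (V W : lmodType K) (A : set V) (B : set W) f :
  linear_iso A B f -> exists g : W -> V, [/\ linear_iso B A g,
    (forall v, A v -> g (f v) = v) & forall w, B w -> f (g w) = w].
Proof.
move=> [subA subB flin [fAB finj fsurj]].
pose g w := xget 0 [set v | A v /\ f v = w].
have gP w : B w -> A (g w) /\ f (g w) = w.
  move=> /fsurj[v Av fv].
  by have := @xgetPex _ 0 [set v | A v /\ f v = w]; apply; exists v.
have gf v : A v -> g (f v) = v.
  by move=> Av; have [Ag fg] := gP _ (fAB _ Av); apply: finj; rewrite ?inE.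
exists g; split=> // [|w /gP[]//]; split=> //.
  move=> a u v Bu Bv; have [Au fu] := gP _ Bu; have [Av fv] := gP _ Bv.
  rewrite -{1}fu -{1}fv -flin// gf//; exact: subA.2.
split=> [w /gP[]//|w w' |v Av]; last by exists (f v); [exact: fAB|exact: gf].
by rewrite !inE => /gP[_ {2}<-] /gP[_ {2}<-] ->.
Qed.

Lemma linear_iso_comp (V W X : lmodType K) (A : set V) (B : set W) (C : set X) f g :
  linear_iso A B f -> linear_iso B C g -> linear_iso A C (g \o f).
Proof.
move=> [subA subB flin [fAB finj fsurj]] [_ subC glin [gBC ginj gsurj]].
split=> //.
  by move=> a u v Au Av; rewrite /= flin// glin//; exact: fAB.
split=> [v /fAB/gBC//|v v'|x /gsurj[w /fsurj[v Av <-] <-]]; last by exists v.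
rewrite !inE => Av Av' /= gfv; apply: finj; rewrite ?inE//.
by apply: ginj; rewrite ?inE//; exact: fAB.
Qed.

Lemma eigenspace_subspace (V : lmodType K) (A : V -> V) z : linear A ->
  is_subspace (op_eigenspace A z).
Proof.
rewrite /op_eigenspace => lA; split=> /= [|a u v Au Av].
  by have := lA (-1) 0 0; rewrite scaler0 addr0 scaleN1r addNr => ->; rewrite scaler0.
by rewrite lA Au Av scalerDr !scalerA mulrC.
Qed.

Variable V : lmodType K.
Implicit Types u v : alg_dual V.

Lemma dual_linear u : linear u.
Proof. by have /asboolP := dual_funP u. Qed.
HB.instance Definition _ u :=
  GRing.isLinear.Build K V K^o _ (dual_fun u) (dual_linear u).

Lemma dual_eqP u v : (forall f, u f = v f) -> u = v.
Proof. by move=> uv; apply: val_inj; exact/funext. Qed.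

Lemma dual_combE a u v f : (a *: u + v) f = a * u f + v f.
Proof. by []. Qed.

Lemma dual_scaleE a u f : (a *: u) f = a * u f.
Proof. by []. Qed.

Definition mk_dual (f : V -> K^o) (lf : linear f) : alg_dual V :=
  AlgDual (asboolT lf : f \in @linear_pred K V).

Lemma transpose_eigenP (A : {linear V -> V}) z u :
  op_eigenspace (transpose A) z u <-> forall f, u (A f) = z * u f.
Proof.
split=> [uz f|uz]; last exact: dual_eqP.
by rewrite -dual_scaleE -uz.
Qed.

Lemma transpose_linear (A : {linear V -> V}) : linear (transpose A).
Proof. by move=> a u v; apply: dual_eqP. Qed.

End LinearIsos.

Section LocallyConstantFunctions.
Variables (K : fieldType) (X : topologicalType).
Implicit Types F : Clc K X.

Lemma Clc_eqP F F' : (forall x, F x = F' x) -> F = F'.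
Proof. by move=> FF; apply: val_inj; exact/funext. Qed.

Lemma Clc_lc F : locally_constant F.
Proof. by have /asboolP := Clc_funP F. Qed.

Definition mk_Clc (f : X -> K^o) (lf : locally_constant f) : Clc K X :=
  MkClc (asboolT lf : f \in lc_pred).

Lemma Clc_combE a F F' x : (a *: F + F') x = a * F x + F' x.
Proof. by []. Qed.

Lemma Clc_sumE (I : Type) (r : seq I) (P : pred I) (F : I -> Clc K X) x :
  (\sum_(i <- r | P i) F i) x = \sum_(i <- r | P i) F i x.
Proof. by elim/big_rec2: _ => // i y1 y2 _ <-. Qed.

Lemma to_ClcE (f : X -> K^o) : locally_constant f -> to_Clc f = f :> (X -> K^o).
Proof. by move=> lf; rewrite /to_Clc insubdK//; exact/asboolP. Qed.

Lemma lc_cst (a : K) : locally_constant (fun _ : X => a : K^o).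
Proof. by move=> x; near=> y. Unshelve. all: by end_near. Qed.

Lemma lc_mul (f g : X -> K^o) : locally_constant f -> locally_constant g ->
  locally_constant (fun x => f x * g x : K^o).
Proof.
move=> lf lg x; near=> y; congr (_ * _); near: y; [exact: lf|exact: lg].
Unshelve. all: by end_near. Qed.

End LocallyConstantFunctions.

(** * Transfer operator and edge Laplacian *)

Section FirstEdges.
Variables (K : fieldType) (G : fin_graph).
Implicit Types (e : dedge G) (c d : chain G) (F : chain G -> K^o) (h : dedge G -> K^o).

Definition follows e e' : Prop := src e' = tgt e /\ e' <> edge_op e.

Lemma edge_opK : involutive (@edge_op G).
Proof. by move=> e; apply: val_inj; rewrite /= -surjective_pairing. Qed.

Lemma follows_op e e' : follows e e' -> follows (edge_op e') (edge_op e).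
Proof.
move=> [se ne]; split=> [|/(can_inj edge_opK) ee]; first exact: esym.
by apply: ne; rewrite ee edge_opK.
Qed.

Lemma follows_opE e e' : `[<follows (edge_op e') e>] = `[<follows (edge_op e) e'>].
Proof.
apply/idP/idP => /asboolP ee; apply/asboolP;
by rewrite -[X in follows _ X]edge_opK; exact: follows_op.
Qed.

Lemma chain_follows c i : follows (c i) (c i.+1).
Proof. by have [] := chainP c i. Qed.

Definition edges : seq (dedge G) := fset_set [set: dedge G].

Lemma mem_edges e : e \in edges.
Proof. by rewrite /edges in_fset_set ?inE//; exact: finite_dedge. Qed.

Lemma fsum_edges (P : dedge G -> Prop) h :
  \sum_(e \in [set e | P e]) h e = \sum_(e <- edges) if `[<P e>] then h e else 0.
Proof.
rewrite fsbig_mkcond fsbig_finite; last exact: finite_dedge.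
by apply: eq_bigr => e _; congr (if _ then _ else _); rewrite unfold_in.
Qed.

Lemma edges_sum1 e h : (forall e', e' <> e -> h e' = 0) ->
  \sum_(e' <- edges) h e' = h e.
Proof.
move=> h0; rewrite (bigD1_seq e) ?mem_edges ?fset_uniq//=.
by rewrite big1 ?addr0// => e' /eqP; exact: h0.
Qed.

Lemma edge_laplacianE h e : edge_laplacian h e =
  \sum_(e' <- edges) if `[<follows e e'>] then h e' else 0.
Proof. exact: fsum_edges. Qed.

Lemma chain_consP e c : follows e (c 0%N) -> forall i,
  let f i := if i is j.+1 then c j else e in
  tgt (f i) = src (f i.+1) /\ f i.+1 <> edge_op (f i).
Proof. by move=> [se ne] [|i] /=; [split|exact: chainP]. Qed.

(* The junk value [c] is returned if [e] cannot precede [c]. *)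
Definition chain_cons e c : chain G :=
  if pselect (follows e (c 0%N)) is left ec then Chain (chain_consP ec) else c.

Lemma chain_consE e c : follows e (c 0%N) ->
  chain_cons e c 0%N = e /\ chain_shift (chain_cons e c) = c.
Proof.
rewrite /chain_cons => ec; case: pselect => // ?; split=> //; exact: chain_eqP.
Qed.

Lemma chain_shift_inj c d : c 0%N = d 0%N -> chain_shift c = chain_shift d -> c = d.
Proof.
move=> cd0 cd; apply: chain_eqP => -[//|i].
by have := congr1 (fun x : chain G => x i) cd.
Qed.

Lemma transfer_funE F c : transfer_fun F c =
  \sum_(e <- edges) if `[<follows e (c 0%N)>] then F (chain_cons e c) else 0.
Proof.
rewrite /transfer_fun -fsum_edges.
rewrite (@reindex_fsbig _ _ _ _ _ (fun e => chain_cons e c)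
  [set e | follows e (c 0%N)])//.
split=> [e /chain_consE[]//|e e'|d /= <-].
  by rewrite !inE => /chain_consE[ee _] /chain_consE[ee' _] E; rewrite -ee E.
exists (d 0%N); first exact: chain_follows.
have [c0 cs] := @chain_consE (d 0%N) (chain_shift d) (chain_follows d 0).
exact: chain_shift_inj.
Qed.

Lemma transfer_first h c : transfer_fun (fun d => h (d 0%N)) c =
  \sum_(e <- edges) if `[<follows e (c 0%N)>] then h e else 0.
Proof.
rewrite transfer_funE; apply: eq_bigr => e _.
by case: asboolP => // /chain_consE[->].
Qed.

Definition depends_on n F := forall c d, cylinder c n d -> F d = F c.

Lemma depends_le m n F : (m <= n)%N -> depends_on m F -> depends_on n F.
Proof. by move=> mn mF c d cd; apply: mF; exact: cylinder_le cd. Qed.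

(** Prepending an edge uses up one of the edges on which [F] depends. The depth stays at least 1,
    because the first edge decides which edges may be prepended. *)
Lemma depends_transfer n F : depends_on n.+2 F -> depends_on n.+1 (transfer_fun F).
Proof.
move=> nF c d cd; rewrite !transfer_funE cd//; apply: eq_bigr => e _.
case: asboolP => // ec; apply: nF; have ed : follows e (d 0%N) by rewrite cd.
have [c0 cs] := chain_consE ec; have [d0 ds] := chain_consE ed.
case=> [|i] ilt; first by rewrite c0.
have := congr1 (fun x : chain G => x i) cs.
have := congr1 (fun x : chain G => x i) ds.
by rewrite /= => -> ->; exact: cd.
Qed.

Lemma depends_first F : depends_on 1 F -> forall c d, c 0%N = d 0%N -> F c = F d.
Proof. by move=> dF c d cd; apply: dF => i; rewrite ltnS leqn0 => /eqP ->. Qed.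

Lemma depends_lc n F : depends_on n F -> locally_constant F.
Proof. by move=> nF; apply/lc_chainP => c; exists n => d; exact: nF. Qed.

Lemma finite_neighbours_fin (a : G) : finite_set [set b | edge a b].
Proof. by apply: sub_finite_set (finite_vertices G). Qed.

Lemma Clc_depends (F : Clc K (chain G)) : exists n, depends_on n F.
Proof.
have cG : compact [set: chain G].
  have -> : [set: chain G] = [set c : chain G | [set: G] (src (c 0%N))] by [].
  by apply: chain_compact; [exact: finite_vertices|exact: finite_neighbours_fin].
by have [n nF] := lc_uniform cG (Clc_lc F); exists n => c d; exact: nF.
Qed.

Lemma transfer_iter_first (F : Clc K (chain G)) :
  exists n, depends_on 1 (iter n (@transfer_op K G) F).
Proof.
(* With depth [n.+1] each of the [n] iterations removes one edge, ending at depth 1; this also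
   covers [n = 0]. *)
have [n /(depends_le (leqnSn n)) nF] := Clc_depends F; exists n.
elim: n F nF => [//|n IHn] F nF; rewrite iterSr; apply: IHn.
exact: depends_transfer.
Qed.

Lemma first_edge_lc h : locally_constant (fun c : chain G => h (c 0%N) : K^o).
Proof.
by apply: (@depends_lc 1) => c d /(_ 0%N isT) ->.
Qed.

Definition first_edge h : Clc K (chain G) := mk_Clc (first_edge_lc h).

Definition edge_ind e : Clc K (chain G) := first_edge (fun e' => (e' == e)%:R).

Lemma first_edge_sum h : first_edge h = \sum_(e <- edges) (h e : K) *: edge_ind e.
Proof.
apply: Clc_eqP => c; rewrite Clc_sumE (@edges_sum1 (c 0%N)) /=.
  by rewrite !fctE eqxx /GRing.scale /= mulr1.
by move=> e ec; rewrite !fctE eq_sym; case: eqP => // _; rewrite scaler0.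
Qed.

Lemma transfer_first_edge h : transfer_op (first_edge h) =
  first_edge (fun e' => \sum_(e <- edges) if `[<follows e e'>] then h e else 0).
Proof. by apply: Clc_eqP => c; exact: transfer_first. Qed.

Lemma iter_transfer_linear n : linear (iter n (@transfer_op K G)).
Proof. by elim: n => // n IHn a F F' /=; rewrite IHn linearP. Qed.

Lemma depends1_iter m n (F : Clc K (chain G)) : (m <= n)%N ->
  depends_on 1 (iter m (@transfer_op K G) F) ->
  depends_on 1 (iter n (@transfer_op K G) F).
Proof.
move=> mn mF; rewrite -(subnK mn); elim: (n - m)%N => // k IHk.
by rewrite addSn iterS; apply: depends_transfer; exact: depends_le IHk.
Qed.

End FirstEdges.

(** * Eigenspaces of the transfer operator, its transpose and the edge Laplacian *)

Section EdgeEigenfunctions.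
Variables (K : fieldType) (G : fin_graph) (z : K).
Hypotheses (G_no_dead_ends : no_dead_ends G) (z_neq0 : z != 0).
Implicit Types (e : dedge G) (c d : chain G) (F : Clc K (chain G)).
Implicit Types (f h : dedge G -> K^o) (u : alg_dual (Clc K (chain G))).

Local Notation L := (@transfer_op K G).
Local Notation EL' := (op_eigenspace (transpose L) z).
Local Notation EL := (op_eigenspace L z).
Local Notation Elap := (op_eigenspace (@edge_laplacian K G) z).

Lemma transfer_eigenP u : EL' u <-> forall F, u (L F) = z * u F.
Proof. exact: transpose_eigenP. Qed.

Lemma edge_laplacian_linear : linear (@edge_laplacian K G).
Proof.
move=> a f h; apply/funext => e; rewrite !fctE !edge_laplacianE scaler_sumr -big_split.
by apply: eq_bigr => e' _ /=; case: ifP => //; rewrite scaler0 addr0.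
Qed.

(** Evaluation at these chains turns a function of the first edge into a function on all edges; here
    the absence of dead ends enters. *)
Definition first_chain e : chain G := sval (cid (G_no_dead_ends e)).

Lemma first_chain0 e : first_chain e 0%N = e.
Proof. by rewrite /first_chain; case: cid. Qed.

Lemma depends1_first_edge F : depends_on 1 F ->
  F = first_edge (fun e => F (first_chain e)).
Proof.
move=> dF; apply: Clc_eqP => c /=; apply: depends_first dF _ _ _.
by rewrite first_chain0.
Qed.

Definition edge_values u : dedge G -> K^o := fun e => u (edge_ind K e).

Lemma dual_first_edge u h :
  u (first_edge h) = \sum_(e <- edges G) h e * edge_values u e.
Proof. by rewrite first_edge_sum linear_sum; apply: eq_bigr => e _; rewrite linearZ. Qed.

Lemma transfer_edge_ind e : L (edge_ind K e) =
  first_edge (fun e' => if `[<follows e e'>] then 1 else 0).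
Proof.
rewrite transfer_first_edge; congr first_edge; apply/funext => e'.
rewrite (@edges_sum1 _ _ e) ?eqxx// => e'' /eqP/negPf ->.
by case: ifP.
Qed.

Lemma dual_iter u n F : EL' u -> u (iter n L F) = z ^+ n * u F.
Proof.
move=> /transfer_eigenP uz; elim: n => [|n IHn]; first by rewrite mul1r.
by rewrite iterS uz IHn mulrA -exprS.
Qed.

Definition edge_pairing f F : K^o := \sum_(e <- edges G) f e * F (first_chain e).

Lemma edge_pairing_linear f : linear (edge_pairing f).
Proof.
move=> a F F'; rewrite /edge_pairing scaler_sumr -big_split; apply: eq_bigr => e _.
by rewrite [RHS]/= Clc_combE mulrDr mulrCA.
Qed.

Lemma edge_pairing_transfer f F : Elap f -> depends_on 1 F ->
  edge_pairing f (L F) = z * edge_pairing f F.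
Proof.
move=> fz /depends1_first_edge ->; rewrite transfer_first_edge.
set h := fun e => F _; rewrite /edge_pairing mulr_sumr.
(* On functions of the first edge [L] sums over predecessors, whereas the Laplacian sums over
   successors; both sides are this double sum over pairs of consecutive edges. *)
transitivity (\sum_(e <- edges G) \sum_(e' <- edges G)
    if `[<follows e e'>] then h e * f e' else 0).
  rewrite exchange_big; apply: eq_bigr => e _ /=; rewrite first_chain0 mulr_sumr.
  by apply: eq_bigr => e' _; case: ifP; rewrite ?mulr0// mulrC.
apply: eq_bigr => e _ /=; rewrite first_chain0 mulrA.
have <- : edge_laplacian f e = z * f e by rewrite [in LHS]fz.
rewrite edge_laplacianE mulr_suml; apply: eq_bigr => e' _.
by case: ifP; rewrite ?mul0r// mulrC.
Qed.

(** An eigendistribution satisfies [u F = z ^- n * u (iter n L F)], and once [iter n L F] depends on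
    the first edge only, the right side is determined by the edge values [f]. *)
Definition edge_extension f F : K^o :=
  let n := sval (cid (transfer_iter_first F)) in
  z ^- n * edge_pairing f (iter n L F).

Lemma edge_extensionE f n F : Elap f -> depends_on 1 (iter n L F) ->
  edge_extension f F = z ^- n * edge_pairing f (iter n L F).
Proof.
move=> fz dn; rewrite /edge_extension; case: cid => m /= dm.
(* A further iteration multiplies the pairing by [z], which the power of [z] in front cancels; so
   the value does not depend on the number of iterations. *)
wlog mn : n m dn dm / (m <= n)%N.
  by move=> H; case: (leqP m n) => [|/ltnW] nm; [exact: H|exact/esym/H].
rewrite -(subnK mn); elim: (n - m)%N => // k IHk.
rewrite addSn iterS edge_pairing_transfer//; last first.
  by apply: depends1_iter dm; lia.
by rewrite IHk mulrA; congr (_ * _); rewrite exprSr invfM divfK.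
Qed.

Lemma edge_extension_linear f : Elap f -> linear (edge_extension f).
Proof.
move=> fz a F F'.
have [m dm] := transfer_iter_first F; have [n dn] := transfer_iter_first F'.
have {}dm : depends_on 1 (iter (maxn m n) L F) by apply: depends1_iter dm; lia.
have {}dn : depends_on 1 (iter (maxn m n) L F') by apply: depends1_iter dn; lia.
rewrite !(@edge_extensionE f (maxn m n))//; last first.
  rewrite iter_transfer_linear => c d cd; rewrite !Clc_combE.
  by rewrite (dm _ _ cd) (dn _ _ cd).
by rewrite iter_transfer_linear edge_pairing_linear mulrDr mulrCA.
Qed.

Lemma edge_values_iso : linear_iso EL' Elap edge_values.
Proof.
split; first by apply: eigenspace_subspace; exact: transpose_linear.
- by apply: eigenspace_subspace; exact: edge_laplacian_linear.
- by [].
split=> [u /transfer_eigenP uz|u v|f fz].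
- apply/funext => e; rewrite edge_laplacianE; apply/esym.
  rewrite -[LHS]/(z * u (edge_ind K e)) -uz transfer_edge_ind dual_first_edge.
  by apply: eq_bigr => e' _; case: ifP; rewrite ?mul1r ?mul0r.
(* After [n] transfers [F] is a function of the first edge, on which [u] and [v] agree; the factor
   [z ^+ n] is then cancelled. *)
- rewrite !inE => uz vz uv; apply: dual_eqP => F.
  have [n /depends1_first_edge dn] := transfer_iter_first F.
  apply: (mulfI (expf_neq0 n z_neq0)); rewrite -!dual_iter// dn !dual_first_edge.
  by rewrite uv.
- have lu := edge_extension_linear fz; exists (mk_dual lu).
    apply/transfer_eigenP => F /=.
    have [n dn] := transfer_iter_first F.
    rewrite !(@edge_extensionE f n)//; last first.
      by rewrite -iterSr; apply: depends1_iter dn.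
    by rewrite -iterSr iterS edge_pairing_transfer// mulrCA.
  apply/funext => e; rewrite /edge_values /= (@edge_extensionE f 0)//=; last first.
    by move=> c d /(_ 0%N isT) /= ->.
  rewrite expr0 invr1 mul1r /edge_pairing (@edges_sum1 _ _ e) /=.
    by rewrite first_chain0 eqxx mulr1.
  by move=> e' ee'; rewrite first_chain0; case: eqP => // _; rewrite mulr0.
Qed.

Definition reverse_first f : Clc K (chain G) := first_edge (f \o @edge_op G).

(** Reversal of edges exchanges predecessors and successors, so the sum over predecessors, reindexed
    by [edge_op], becomes the Laplacian at the reversed edge. *)
Lemma transfer_reverse_first f : L (reverse_first f) = reverse_first (edge_laplacian f).
Proof.
rewrite /reverse_first transfer_first_edge; congr first_edge; apply/funext => e /=.
rewrite edge_laplacianE.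
transitivity (\sum_(e' <- edges G)
    if `[<follows (edge_op (edge_op e')) e>] then f (edge_op e') else 0).
  by apply: eq_bigr => e' _; rewrite edge_opK.
rewrite -(big_map (@edge_op G) predT
  (fun e' => if `[<follows (edge_op e') e>] then f e' else 0)).
rewrite (perm_big (edges G)).
  by apply: eq_bigr => e' _; rewrite follows_opE.
apply: uniq_perm; rewrite ?(map_inj_uniq (can_inj (@edge_opK G))) ?fset_uniq//.
by move=> e'; rewrite mem_edges -[e']edge_opK map_f ?mem_edges.
Qed.

Lemma reverse_first_iso : linear_iso Elap EL reverse_first.
Proof.
split; first by apply: eigenspace_subspace; exact: edge_laplacian_linear.
- by apply: eigenspace_subspace; exact: linearP.
- by move=> a f h _ _; exact: Clc_eqP.
split=> [f fz|f h _ _ fh|F Fz].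
- by rewrite /op_eigenspace /= transfer_reverse_first fz; exact: Clc_eqP.
- apply/funext => e; have := congr1 (fun F : Clc K (chain G) => F (first_chain (edge_op e))) fh.
  by rewrite /= first_chain0 edge_opK.
(* An eigenfunction is a nonzero multiple of its iterates, and these eventually depend on the first
   edge only. *)
have Fn n : iter n L F = z ^+ n *: F.
  elim: n => [|n IHn]; first by rewrite scale1r.
  by rewrite iterS IHn linearZ /= Fz scalerA -exprSr.
have /depends1_first_edge FE : depends_on 1 F.
  have [n dn] := transfer_iter_first F => c d /dn; rewrite Fn.
  by move=> /(mulfI (expf_neq0 n z_neq0)).
pose f e := F (first_chain (edge_op e)).
have fF : reverse_first f = F.
  rewrite [RHS]FE; congr first_edge; apply/funext => e.
  by rewrite /f /= edge_opK.
exists f => //; apply/funext => e.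
have := congr1 (fun F : Clc K (chain G) => F (first_chain (edge_op e)))
  (transfer_reverse_first f).
by rewrite fF Fz /= first_chain0 edge_opK => <-.
Qed.

End EdgeEigenfunctions.

(** * Boundary values of eigendistributions *)

Section BoundaryValues.
Variables (K : fieldType) (T : tree) (G : fin_graph) (p : covering T G).
Variables (o : T) (z : K).
Hypothesis z_neq0 : z != 0.
Implicit Types (x y : T) (w : boundary T) (c : chain G) (g : automorphism T).
Implicit Types (F : Clc K (boundary T)) (u : alg_dual (Clc K (chain G))).

Local Notation L := (@transfer_op K G).
Local Notation EL' := (op_eigenspace (transpose L) z).

Definition proj_path x w : chain G := cmap p (chain_from x w).

Lemma proj_path_src x w : src (proj_path x w 0%N) = p x.
Proof. by rewrite /proj_path cmap_src chain_from0. Qed.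

Lemma proj_path_surj x c : p x = src (c 0%N) -> exists w, proj_path x w = c.
Proof.
by move=> /chain_lift[d dx <-]; exists (endpoint d); rewrite /proj_path -dx endpointK.
Qed.

Lemma proj_path_inj x : injective (proj_path x).
Proof.
move=> w w' /cmap_inj; rewrite !chain_from0 => /(_ erefl) ww'.
by rewrite -(chain_fromK x w) ww' chain_fromK.
Qed.

Lemma chain_from_map g x w : chain_from (g x) (bmap g w) = cmap g (chain_from x w).
Proof. by apply: chain_src_inj => i; rewrite chain_from_src ray_from_map. Qed.

Lemma proj_path_deck g x w : deck p g -> proj_path (g x) (bmap g w) = proj_path x w.
Proof. by move=> dg; rewrite /proj_path chain_from_map cmap_deck. Qed.

Lemma proj_path_edge e w : proj_path (src e) w 0%N = emap p e <-> bd_plus e w.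
Proof.
split=> [we|/bd_plusE we]; last exact: (congr1 (emap p) we).
have := congr1 (@tgt G) we; rewrite /proj_path /bd_plus /tgt /=.
apply: (@cov_local_inj _ _ p (src e)); last exact: (valP e).
by case: (rayP (ray_from (src e) w) 0); rewrite ray_from0.
Qed.

Lemma lc_proj_path (f : chain G -> K^o) x : locally_constant f ->
  locally_constant (fun w => f (proj_path x w)).
Proof.
move=> /lc_chainP lf w; have [n nf] := lf (proj_path x w).
apply: filterS (near_chain_from x w n) => w' ww'.
by apply: nf; exact: cylinder_cmap.
Qed.

(** [proj_path x] is a bijection from the ends onto the chains starting at [p x]; functions are
    carried over by it and extended by 0 to the other chains. *)
Definition path_ext x (f : boundary T -> K^o) : chain G -> K^o := fun c =>
  if pselect (exists w, proj_path x w = c) is left h then f (sval (cid h)) else 0.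

Lemma path_extE x f w : path_ext x f (proj_path x w) = f w.
Proof.
rewrite /path_ext; case: pselect => [h|[]]; last by exists w.
by case: cid => w' /= /proj_path_inj ->.
Qed.

Lemma path_ext0 x f c : p x <> src (c 0%N) -> path_ext x f c = 0.
Proof.
rewrite /path_ext; case: pselect => // h; have [w wc] := h.
by move=> xc; case: xc; rewrite -wc proj_path_src.
Qed.

Lemma path_ext_unique x f (h : chain G -> K^o) :
  (forall w, h (proj_path x w) = f w) ->
  (forall c, p x <> src (c 0%N) -> h c = 0) -> h = path_ext x f.
Proof.
move=> hf h0; apply/funext => c; have [/proj_path_surj[w <-]|] := EM (p x = src (c 0%N)).
  by rewrite hf path_extE.
by move=> xc; rewrite h0// path_ext0.
Qed.

Lemma path_ext_lc x f : locally_constant f -> locally_constant (path_ext x f).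
Proof.
move=> lf; apply/lc_chainP => c.
have [xc|xc] := EM (p x = src (c 0%N)); last first.
  exists 1%N => d /(_ 0%N isT) cd; rewrite !path_ext0// cd//.
have [w wc] := proj_path_surj xc.
have /(nbhs_boundary x)[n nf] := lf w.
(* At least one edge must be prescribed, so that [d] also starts at [p x]. *)
exists n.+1 => d; rewrite -wc => cd.
have xd : p x = src (d 0%N) by rewrite (cylinder_src cd)// proj_path_src.
have [w' w'd] := proj_path_surj xd.
rewrite -w'd !path_extE; apply: nf => i ilt.
rewrite -!chain_from_src; apply: cylinder_tgt (leqW ilt).
by apply: (@cylinder_cmap_inj _ _ p); [rewrite !chain_from0|rewrite -w'd in cd].
Qed.

Definition Clc_ext x F : Clc K (chain G) := mk_Clc (path_ext_lc x (Clc_lc F)).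

Lemma Clc_ext_linear x : linear (Clc_ext x).
Proof.
move=> a F F'; apply: Clc_eqP => c; rewrite Clc_combE /=.
have [/proj_path_surj[w <-]|xc] := EM (p x = src (c 0%N)).
  by rewrite !path_extE.
by rewrite !path_ext0// mulr0 addr0.
Qed.
HB.instance Definition _ x := GRing.isLinear.Build K (Clc K (boundary T))
  (Clc K (chain G)) _ (Clc_ext x) (Clc_ext_linear x).

Lemma Clc_ext_deck g x F F' : deck p g -> (forall w, F' w = F (bmap g w)) ->
  Clc_ext x F' = Clc_ext (g x) F.
Proof.
move=> dg FF; apply/val_inj/esym; apply: path_ext_unique => [w|c]; rewrite /=.
  by rewrite -(proj_path_deck x w dg) path_extE FF.
by move=> xc; rewrite path_ext0// dg.
Qed.

(* A path of [T] from [tgt e] to [w] has a predecessor through [e], which is the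
   path from [src e] to [w], iff [w] belongs to [bd_plus e]. *)
Lemma transfer_proj_path (f : chain G -> K^o) e w :
  (forall c, c 0%N <> emap p e -> f c = 0) ->
  transfer_fun f (proj_path (tgt e) w) = f (proj_path (src e) w).
Proof.
move=> f0; rewrite transfer_funE (@edges_sum1 _ _ (emap p e)); last first.
  by move=> e' ee'; case: asboolP => // /chain_consE[e'0 _]; rewrite f0// e'0.
case: asboolP => [/[dup] fe /chain_consE[e0 es]|nf].
  have we : bd_plus e w.
    apply: contrapT => /bd_plus_op/bd_plusE opw; apply: fe.2.
    rewrite [LHS](congr1 (emap p) opw); exact: val_inj.
  congr f; apply: chain_shift_inj.
    by rewrite e0; apply/esym/proj_path_edge.
  rewrite es /proj_path -(chain_shift_from we).
  exact: chain_eqP.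
rewrite f0// => /proj_path_edge we; apply: nf.
have := chain_follows (proj_path (src e) w) 0.
have -> : proj_path (src e) w 0%N = emap p e by exact/proj_path_edge.
by rewrite [X in follows _ X -> _](_ : _ = proj_path (tgt e) w 0%N)//
  /proj_path -(chain_shift_from we).
Qed.

Lemma transfer_Clc_ext e F : (forall w, ~ bd_plus e w -> F w = 0) ->
  L (Clc_ext (src e) F) = Clc_ext (tgt e) F.
Proof.
move=> F0; apply/val_inj.
have ext0 c : c 0%N <> emap p e -> Clc_ext (src e) F c = 0.
  have [/proj_path_surj[w <-]|xc] := EM (p (src e) = src (c 0%N)).
    by move=> we; rewrite /= path_extE F0//; apply: contra_not we => /proj_path_edge.
  by move=> _; exact: path_ext0.
apply: path_ext_unique => [w|c tc].
  by rewrite [LHS]transfer_proj_path//; exact: path_extE.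
rewrite [LHS]transfer_funE big1// => e' _; case: asboolP => // /[dup] fe.
move=> /chain_consE[e'0 _]; apply: ext0; rewrite e'0 => ee'; apply: tc.
by rewrite fe.1 ee'.
Qed.

Lemma lc_horo x y : locally_constant (fun w => z ^ horo_bracket x y w : K^o).
Proof. by move=> w; apply: filterS (near_horo_bracket x y w) => w' ->. Qed.

(** The density for changing the base point from [x] to [y]: see [Clc_ext_transport] for
    eigendistributions and [pi_zE] for the action of automorphisms. *)
Definition twist x y F : Clc K (boundary T) :=
  mk_Clc (lc_mul (lc_horo x y) (Clc_lc F)).

Lemma twist_comp x y t F : twist x y (twist y t F) = twist x t F.
Proof.
by apply: Clc_eqP => w /=; rewrite mulrA -expfzDr// horo_bracket_cocycle.
Qed.

Lemma twist_linear x y : linear (twist x y).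
Proof.
move=> a F F'; apply: Clc_eqP => w; rewrite Clc_combE /=.
by rewrite [LHS]mulrDr [X in X + _]mulrCA.
Qed.
HB.instance Definition _ x y := GRing.isLinear.Build K (Clc K (boundary T))
  (Clc K (boundary T)) _ (twist x y) (twist_linear x y).

Lemma lc_bd_plus e (f : boundary T -> K^o) : locally_constant f ->
  locally_constant (fun w => if w \in bd_plus e then f w else 0 : K^o).
Proof.
move=> lf w; near=> w'.
have -> : (w' \in bd_plus e) = (w \in bd_plus e).
  rewrite !unfold_in /bd_plus /=; congr (`[< _ = _ >]).
  near: w'; apply: filterS (near_ray_from (src e) w 1) => w' /(_ 1%N); exact.
by case: ifP => // _; near: w'; exact: lf.
Unshelve. all: by end_near. Qed.

Definition Clc_restrict e F : Clc K (boundary T) := mk_Clc (lc_bd_plus e (Clc_lc F)).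

Lemma Clc_restrict_split e F : F = Clc_restrict e F + Clc_restrict (edge_op e) F.
Proof.
apply: Clc_eqP => w; rewrite [RHS]/= !fctE /=.
have [we|we] := boolP (w \in bd_plus e).
  case: ifPn; last by rewrite addr0.
  by rewrite inE => /bd_plus_op; rewrite inE in we.
case: ifPn; first by rewrite add0r.
rewrite notin_setE => /bd_plus_op; rewrite notin_setE in we.
by [].
Qed.

Lemma Clc_restrict0 e F w : ~ bd_plus e w -> Clc_restrict e F w = 0.
Proof. by rewrite /= => we; case: ifPn => //; rewrite inE. Qed.

(** The ends split into those beyond [e], where the bracket is 1, and those beyond [edge_op e],
    where it is -1. On each half [L] moves the base point across the edge, in opposite directions,
    and [u] turns [L] into the factor [z]. *)
Lemma Clc_ext_step u e F : EL' u ->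
  u (Clc_ext (tgt e) F) = u (Clc_ext (src e) (twist (src e) (tgt e) F)).
Proof.
move=> /transfer_eigenP uz; rewrite [F in RHS](Clc_restrict_split e) {1}(Clc_restrict_split e F).
rewrite !linearD /=; congr (_ + _).
  rewrite -transfer_Clc_ext; last by move=> w; exact: Clc_restrict0.
  rewrite uz -[LHS]linearZ -linearZ; congr (u _); congr Clc_ext.
  apply: Clc_eqP => w; rewrite -[LHS]/(z * Clc_restrict e F w).
  rewrite -[RHS]/(z ^ horo_bracket (src e) (tgt e) w * Clc_restrict e F w).
  have [we|/Clc_restrict0 ->] := EM (bd_plus e w); last by rewrite !mulr0.
  by rewrite (horo_bracket_step we) expr1z.
set F' := Clc_restrict _ F.
have F'0 w : ~ bd_plus (edge_op e) w -> F' w = 0 by exact: Clc_restrict0.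
have E : L (Clc_ext (tgt e) F') = Clc_ext (src e) F' := transfer_Clc_ext F'0.
have -> : twist (src e) (tgt e) F' = z^-1 *: F'.
  apply: Clc_eqP => w; rewrite -[RHS]/(z^-1 * F' w).
  rewrite -[LHS]/(z ^ horo_bracket (src e) (tgt e) w * F' w).
  have [we|/F'0 ->] := EM (bd_plus (edge_op e) w); last by rewrite !mulr0.
  by rewrite horo_bracket_sym (horo_bracket_step we) exprN1.
by rewrite !linearZ -[RHS]/(z^-1 * u (Clc_ext (src e) F')) -E uz mulKf.
Qed.

End BoundaryValues.

(** * Eigendistributions and invariant boundary distributions *)

Section BoundaryDistributions.
Variables (K : fieldType) (T : tree) (G : fin_graph) (p : covering T G).
Variables (o : T) (z : K).
Hypotheses (G_connected : connected_graph G) (G_no_dead_ends : no_dead_ends G).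
Hypothesis z_neq0 : z != 0.
Implicit Types (x y : T) (w : boundary T) (c : chain G) (g : automorphism T).
Implicit Types (F : Clc K (boundary T)) (u : alg_dual (Clc K (chain G))).
Implicit Types (mu : alg_dual (Clc K (boundary T))) (f : Clc K (chain G)).

Local Notation L := (@transfer_op K G).
Local Notation EL' := (op_eigenspace (transpose L) z).
Local Notation twist := (@twist K T z).
Local Notation Clc_ext := (@Clc_ext K T G p).
Local Notation inv := (@invariants K T o z (deck p)).

Lemma twist_id x F : twist x x F = F.
Proof. by apply: Clc_eqP => w /=; rewrite horo_bracket_id expr0z mul1r. Qed.

Lemma Clc_ext_transport u x y F : EL' u ->
  u (Clc_ext y F) = u (Clc_ext x (twist x y F)).
Proof.
move=> uz; have [/(_ x y)[s ps <-] _] := tree_sc T.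
elim: s x ps => [|t s IHs] x /=; first by rewrite twist_id.
move=> /andP[xt /IHs ->].
have := Clc_ext_step p z_neq0 (exist _ (x, t) xt) (twist t (last t s) F) uz.
by rewrite /src /tgt /= => ->; rewrite twist_comp.
Qed.

Lemma lc_bmap g (h : boundary T -> K^o) : locally_constant h ->
  locally_constant (h \o bmap g).
Proof. by move=> lh w; exact: (@bmap_cvg _ g w _ (lh (bmap g w))). Qed.

Definition Clc_bmap g F : Clc K (boundary T) := mk_Clc (lc_bmap g (Clc_lc F)).

(** By antisymmetry of the bracket the factor in [pi_z] is a change of base point. The function
    under [to_Clc] is thus locally constant, and the default value does not occur. *)
Lemma pi_zE g mu F : pi_z o z g mu F = mu (Clc_bmap g (twist (g o) o F)).
Proof.
congr (mu _); apply/val_inj => /=.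
have -> : (fun w => z ^ (- horo_bracket o (g o) (bmap g w)) * F (bmap g w)) =
    Clc_bmap g (twist (g o) o F).
  by apply/funext => w /=; rewrite [horo_bracket (g o) o _]horo_bracket_sym.
by rewrite to_ClcE//; exact: Clc_lc.
Qed.

Lemma invariants_subspace : is_subspace inv.
Proof.
split=> [g _|a mu nu imu inu g dg]; apply/funext => F; first by rewrite pi_zE.
by rewrite pi_zE dual_combE -!pi_zE imu// inu.
Qed.

Definition boundary_value u : alg_dual (Clc K (boundary T)) :=
  mk_dual (fun a F F' => etrans (congr1 u (linearP (Clc_ext o) a F F'))
    (linearP (dual_fun u) a _ _)).

Lemma boundary_valueE u F : boundary_value u F = u (Clc_ext o F).
Proof. by []. Qed.

(** Deck transformations preserve projected paths, so translating by [g] moves the base point of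
    [Clc_ext] from [o] to [g o]; transport back to [o] undoes the twist. *)
Lemma boundary_value_invariant u : EL' u -> inv (boundary_value u).
Proof.
move=> uz g dg; apply/funext => F; rewrite pi_zE !boundary_valueE.
rewrite (@Clc_ext_deck _ _ _ p g o (twist (g o) o F))//.
by rewrite (Clc_ext_transport o)// twist_comp// twist_id.
Qed.

Definition Clc_one : Clc K (boundary T) := mk_Clc (lc_cst (1 : K)).

Lemma edge_poissonE mu e :
  edge_poisson o z mu e = mu (twist o (src e) (Clc_restrict e Clc_one)).
Proof.
congr (mu _); apply/val_inj => /=.
have -> : (fun w => if w \in bd_plus e then z ^ horo_bracket o (src e) w else 0) =
    twist o (src e) (Clc_restrict e Clc_one).
  by apply/funext => w /=; case: ifP; rewrite ?mulr1 ?mulr0.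
by rewrite to_ClcE//; exact: Clc_lc.
Qed.

Lemma Clc_ext_edge e : Clc_ext (src e) (Clc_restrict e Clc_one) = edge_ind K (emap p e).
Proof.
apply/val_inj/esym; apply: path_ext_unique => [w|c xc] /=.
  case: eqP => [/proj_path_edge we|we]; first by rewrite mem_set.
  have nwe : ~ bd_plus e w by move=> /(proj_path_edge p).
  by rewrite (memNset nwe).
by case: eqP => // ce; case: xc; rewrite ce.
Qed.

(** Transport from [o] to [src e] absorbs the Poisson kernel and leaves the indicator of
    [bd_plus e], which projects to that of the chains starting with [emap p e]. *)
Lemma edge_poisson_boundary_value u e : EL' u ->
  edge_poisson o z (boundary_value u) e = edge_values u (emap p e).
Proof.
move=> uz; rewrite edge_poissonE boundary_valueE -(Clc_ext_transport o (src e))//.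
by rewrite Clc_ext_edge.
Qed.

Definition Clc_pull x f : Clc K (boundary T) := mk_Clc (lc_proj_path p x (Clc_lc f)).

Lemma Clc_pull_linear x : linear (Clc_pull x).
Proof. by move=> a f f'; exact: Clc_eqP. Qed.
HB.instance Definition _ x := GRing.isLinear.Build K (Clc K (chain G))
  (Clc K (boundary T)) _ (Clc_pull x) (Clc_pull_linear x).

Definition path_integral mu x f : K^o := mu (twist o x (Clc_pull x f)).

Lemma path_integral_linear mu x : linear (path_integral mu x).
Proof. by move=> a f f'; rewrite /path_integral !linearP. Qed.

(** For a deck transformation [g] with [g x = y], invariance of [mu] replaces the base point [o] by
    [g o]; the bracket of [g x] seen from [g o] is that of [x] seen from [o], and projected paths do
    not change. *)
Lemma path_integral_fiber mu x y f : inv mu -> p x = p y ->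
  path_integral mu x f = path_integral mu y f.
Proof.
move=> imu /deck_transitive[g dg <-].
rewrite /path_integral -[in RHS](imu g dg) pi_zE twist_comp//.
congr (mu _); apply: Clc_eqP => w /=.
by rewrite horo_bracket_map proj_path_deck.
Qed.

Definition vertex_lift a : T := sval (cid (cov_surj p o a G_connected)).

Lemma vertex_liftK a : p (vertex_lift a) = a.
Proof. by rewrite /vertex_lift; case: cid. Qed.

Definition vertices : seq G := fset_set [set: G].

Lemma mem_vertices a : a \in vertices.
Proof. by rewrite /vertices in_fset_set ?inE//; exact: finite_vertices. Qed.

Lemma vertices_sum1 a (h : G -> K^o) : (forall b, b <> a -> h b = 0) ->
  \sum_(b <- vertices) h b = h a.
Proof.
move=> h0; rewrite (bigD1_seq a) ?mem_vertices ?fset_uniq//=.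
by rewrite big1 ?addr0// => b /eqP; exact: h0.
Qed.

(** The chains are sorted by their starting vertex, each class being integrated from a chosen point
    of the fiber. For invariant [mu] the choice is immaterial by [path_integral_fiber]. *)
Definition descend_fun mu f : K^o :=
  \sum_(a <- vertices) path_integral mu (vertex_lift a) f.

Lemma descend_linear mu : linear (descend_fun mu).
Proof.
move=> a f f'; rewrite /descend_fun scaler_sumr -big_split; apply: eq_bigr => b _.
exact: path_integral_linear.
Qed.

Definition descend mu : alg_dual (Clc K (chain G)) := mk_dual (descend_linear mu).

Lemma descend_vertex mu x f : inv mu ->
  (forall c, src (c 0%N) <> p x -> f c = 0) -> descend mu f = path_integral mu x f.
Proof.
move=> imu f0; rewrite [LHS](@vertices_sum1 (p x)) => [|b bx].
  by apply: path_integral_fiber => //; rewrite vertex_liftK.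
rewrite /path_integral [twist _ _ _](_ : _ = 0) ?linear0//.
apply: Clc_eqP => w /=; rewrite f0 ?mulr0// proj_path_src vertex_liftK.
exact: bx.
Qed.

Lemma edge_part_lc e f : locally_constant
  (fun c : chain G => (c 0%N == e)%:R * f c : K^o).
Proof.
by apply: lc_mul (Clc_lc f); exact: (@first_edge_lc K G (fun e' => (e' == e)%:R)).
Qed.
Definition edge_part e f : Clc K (chain G) := mk_Clc (edge_part_lc e f).

Lemma edge_part_sum f : f = \sum_(e <- edges G) edge_part e f.
Proof.
apply: Clc_eqP => c; rewrite Clc_sumE (@edges_sum1 _ _ (c 0%N)) /=.
  by rewrite eqxx mul1r.
by move=> e ec; rewrite eq_sym; case: eqP => // _; rewrite mul0r.
Qed.

(** By linearity [f] may be supported on chains with first edge [emap p d]. Then [f] is integrated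
    from [src d] and [L f] from [tgt d], and crossing [d] towards an end multiplies the kernel by
    [z]. *)
Lemma descend_eigen mu : inv mu -> EL' (descend mu).
Proof.
move=> imu; apply/transfer_eigenP => f.
suff part e : descend mu (L (edge_part e f)) = z * descend mu (edge_part e f).
  rewrite {1 2}(edge_part_sum f) !linear_sum mulr_sumr.
  by apply: eq_bigr => e _; exact: part.
have [d <- _] := emap_surj p o e G_connected.
set f' := edge_part _ f.
have f'0 c : c 0%N <> emap p d -> f' c = 0.
  by move=> cd; rewrite /= ; case: eqP => // _; rewrite mul0r.
rewrite (@descend_vertex mu (src d) f')//; last first.
  by move=> c cd; apply: f'0 => cE; apply: cd; rewrite cE.
rewrite (@descend_vertex mu (tgt d))//; last first.
  move=> c cd; rewrite [LHS]transfer_funE big1// => e' _.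
  case: asboolP => // /[dup] fe /chain_consE[e'0 _]; apply: f'0; rewrite e'0 => E.
  by apply: cd; rewrite fe.1 E.
rewrite /path_integral -[RHS]linearZ; congr (mu _); apply: Clc_eqP => w.
rewrite -[LHS]/(z ^ horo_bracket o (tgt d) w * transfer_fun f' (proj_path p (tgt d) w)).
rewrite -[RHS]/(z * (z ^ horo_bracket o (src d) w * f' (proj_path p (src d) w))).
rewrite transfer_proj_path// [RHS]mulrA.
have [we|we] := EM (bd_plus d w); last first.
  by rewrite f'0 ?mulr0// => /proj_path_edge.
rewrite -(horo_bracket_cocycle o (src d)) (horo_bracket_step we) addrC.
by rewrite expfzDr// expr1z.
Qed.

Lemma boundary_value_descend mu : inv mu -> boundary_value (descend mu) = mu.
Proof.
move=> imu; apply: dual_eqP => F; rewrite boundary_valueE (@descend_vertex mu o)//.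
  rewrite /path_integral twist_id; congr (mu _); apply: Clc_eqP => w /=.
  exact: path_extE.
by move=> c /nesym; exact: path_ext0.
Qed.

(** Injectivity passes through the edges: the boundary value determines its Poisson transform, hence
    all edge values because every edge lifts, and these determine [u]. *)
Lemma boundary_value_iso : linear_iso EL' inv boundary_value.
Proof.
split; first by apply: eigenspace_subspace; exact: transpose_linear.
- exact: invariants_subspace.
- by move=> a u v _ _; exact: dual_eqP.
split=> [u|u v|mu imu]; first exact: boundary_value_invariant.
  rewrite !inE => uz vz uv.
  have [_ _ _ [_ inj _]] := edge_values_iso G_no_dead_ends z_neq0.
  apply: inj; rewrite ?inE//; apply/funext => e.
  have [d <- _] := emap_surj p o e G_connected.
  by rewrite -!edge_poisson_boundary_value// uv.
by exists (descend mu); [exact: descend_eigen|exact: boundary_value_descend].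
Qed.

End BoundaryDistributions.

(** * Pull-back to the path space of the tree *)

Section PathPush.
Variables (K : fieldType) (T : tree) (G : fin_graph) (p : covering T G).
Variables (o : T) (z : K).
Hypotheses (G_connected : connected_graph G) (z_neq0 : z != 0).
Implicit Types (x y : T) (w : boundary T) (c : chain T) (g : automorphism T).
Implicit Types (f : Clcc K (chain T)) (u : alg_dual (Clc K (chain G))).

Local Notation L := (@transfer_op K G).
Local Notation EL' := (op_eigenspace (transpose L) z).
Local Notation twist := (@twist K T z).
Local Notation Clc_ext := (@Clc_ext K T G p).

Lemma Clcc_lc f : locally_constant f.
Proof. by have /asboolP[] := Clcc_funP f. Qed.

Lemma near_chain_src (H : graph) (c : chain H) :
  nbhs c [set d : chain H | src (d 0%N) = src (c 0%N)].
Proof. by apply/nbhs_chain; exists 1%N => d /cylinder_src; exact. Qed.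

Lemma endpoint_nbhs c (U : set (boundary T)) : nbhs (endpoint c) U ->
  nbhs c [set d : chain T | U (endpoint d)].
Proof.
move=> /(nbhs_boundary (src (c 0%N)))[n nU]; apply/nbhs_chain; exists n.+1 => d cd.
apply: nU => i ilt; rewrite -!chain_from_src endpointK.
by rewrite -(cylinder_src cd (ltn0Sn n)) endpointK; exact: cylinder_tgt cd (leqW ilt).
Qed.

(** The starting vertex is a locally constant function, so it takes finitely many values on the
    compact support. This makes the sums over all vertices of [T] finite. *)
Lemma starts_finite f : finite_set
  [set src (c 0%N) | c in closure [set c : chain T | f c != 0]].
Proof.
have /asboolP[_ cf] := Clcc_funP f.
exact: compact_finite_image (@near_chain_src T) cf.
Qed.

Definition starts f : seq T :=
  fset_set [set src (c 0%N) | c in closure [set c : chain T | f c != 0]].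

Lemma starts_uniq f : uniq (starts f).
Proof. exact: fset_uniq. Qed.

Lemma starts_out f c : src (c 0%N) \notin starts f -> f c = 0.
Proof.
apply: contraNeq => fc; rewrite /starts in_fset_set; last exact: starts_finite.
by apply/mem_set; exists c => //; exact: subset_closure.
Qed.

Lemma slice_lc x f : locally_constant (fun w => f (chain_from x w)).
Proof.
move=> w; have /lc_chainP/(_ (chain_from x w))[n nf] := Clcc_lc f.
by apply: filterS (near_chain_from x w n) => w' /nf.
Qed.

Definition slice x f : Clc K (boundary T) := mk_Clc (slice_lc x f).

Lemma cmap_surj (d : chain G) : exists2 c : chain T, cmap p c = d & True.
Proof.
have [x px] := cov_surj p o (src (d 0%N)) G_connected.
by have [c _ cd] := chain_lift px; exists c.
Qed.

Lemma path_push_unique f (F : Clc K (chain G)) :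
  (forall c, F (cmap p c) = \sum_(g \in deck p) f (cmap (aut_inv g) c)) ->
  path_push p f = F.
Proof.
move=> FP; have := @xgetPex _ 0 [set F : Clc K (chain G) | forall c,
    F (cmap p c) = \sum_(g \in deck p) f (cmap (aut_inv g) c)] (ex_intro _ F FP).
rewrite -/(path_push p f) /= => pP; apply: Clc_eqP => d.
by have [c <- _] := cmap_surj d; rewrite pP FP.
Qed.

Lemma fsum_seq (I : choiceType) (A : set I) (S : seq I) (h : I -> K^o) : uniq S ->
  (forall i, i \notin S -> h i = 0) -> (forall i, ~ A i -> h i = 0) ->
  \sum_(i \in A) h i = \sum_(i <- S) h i.
Proof.
move=> uS hS hA; rewrite [RHS]fsbig_seq//.
transitivity (\sum_(i \in [set: I]) h i); last apply: esym.
  by apply: fsbig_widen => // i [_ nA]; exact: (hA i nA).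
by apply: fsbig_widen => // i [_ /= /negP nS]; exact: (hS i nS).
Qed.

Lemma slice0 (S : seq T) x f : (forall c, src (c 0%N) \notin S -> f c = 0) ->
  x \notin S -> slice x f = 0.
Proof.
by move=> f0 xS; apply: Clc_eqP => w; rewrite /= f0// chain_from0.
Qed.

(* The paths over [cmap p c] start at the points of the fiber, on which the deck
   group acts simply transitively. *)
Lemma path_push_sum (S : seq T) f : uniq S ->
  (forall c, src (c 0%N) \notin S -> f c = 0) ->
  path_push p f = \sum_(x <- S) Clc_ext x (slice x f).
Proof.
move=> uS f0; apply: path_push_unique => c; rewrite Clc_sumE.
set x0 := src (c 0%N).
rewrite -(@fsum_seq _ [set x | p x = p x0])//; last 2 first.
- by move=> x xS; rewrite (slice0 f0 xS) linear0.
- by move=> x xx0; exact: path_ext0.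
have bij : set_bij (deck p) [set x | p x = p x0] (fun g => aut_inv g x0).
  split=> [g /deck_inv dg|g h|x /= /esym/deck_transitive[g dg gx]]; first exact: dg.
    rewrite !inE => dg dh gh.
    have : aut_inv g = aut_inv h := deck_free (deck_inv dg) (deck_inv dh) gh.
    move=> /(congr1 (fun a => aut_inv a)) E.
    by apply: aut_eq => y; have := congr1 (fun a : automorphism T => a y) E.
  by exists (aut_inv g); [exact: deck_inv|].
rewrite (reindex_fsbig _ _ _ _ bij); apply: eq_fsbigr => g; rewrite inE => dg.
rewrite -{1}(endpointK c) -/x0 -[cmap p _]/(proj_path p x0 (endpoint c)).
rewrite -(proj_path_deck x0 (endpoint c) (deck_inv dg)) [LHS]path_extE.
rewrite -[LHS]/(f (chain_from (aut_inv g x0) (bmap (aut_inv g) (endpoint c)))).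
by rewrite chain_from_map endpointK.
Qed.

Lemma p_z_fun_lcc f : (fun c : chain T =>
  z ^ horo_bracket o (src (c 0%N)) (endpoint c) * f c : K^o) \in lcc_pred.
Proof.
have /asboolP[lf cf] := Clcc_funP f; apply/asboolP; split; last first.
  apply: subclosed_compact cf _; first exact: closed_closure.
  by apply: closureS => c /=; apply: contra_neq => ->; rewrite mulr0.
apply: lc_mul lf => c; near=> d.
have -> : src (d 0%N) = src (c 0%N) by near: d; exact: near_chain_src.
congr (z ^ _); near: d.
exact: (endpoint_nbhs (near_horo_bracket o (src (c 0%N)) (endpoint c))).
Unshelve. all: by end_near. Qed.

Lemma p_zE f c : p_z o z f c = z ^ horo_bracket o (src (c 0%N)) (endpoint c) * f c.
Proof. by rewrite /p_z /to_Clcc insubdK//; exact: p_z_fun_lcc. Qed.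

Lemma slice_p_z x f : slice x (p_z o z f) = twist o x (slice x f).
Proof.
by apply: Clc_eqP => w; rewrite /= p_zE chain_fromK chain_from0.
Qed.

Lemma B_push_sum (S : seq T) f : uniq S ->
  (forall c, src (c 0%N) \notin S -> f c = 0) ->
  B_push f = \sum_(x <- S) slice x f.
Proof.
move=> uS f0; apply/val_inj; rewrite /B_push; set h := (X in to_Clc X).
have -> : h = (\sum_(x <- S) slice x f : Clc K (boundary T)).
  apply/funext => w; rewrite Clc_sumE; apply: fsum_seq => // [x xS|x /(_ I)//].
  by rewrite f0// chain_from0.
exact: (to_ClcE (@Clc_lc _ _ _)).
Qed.

(** Both sides split into finite sums over the starting vertices of [f]; the summands at [x] agree
    by transport from [o] to [x]. *)
Lemma path_pull_boundary_value u : EL' u ->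
  path_pull p u = p_z_mul o z (B_pull (boundary_value p o u)).
Proof.
move=> uz; apply/funext => f; have f0 := @starts_out f.
rewrite /path_pull /p_z_mul /B_pull (path_push_sum (starts_uniq f) f0).
rewrite (B_push_sum (starts_uniq f)); last by move=> c /f0 fc; rewrite p_zE fc mulr0.
rewrite !linear_sum; apply: eq_bigr => x _.
by rewrite slice_p_z; exact: (Clc_ext_transport p z_neq0 o x (slice x f) uz).
Qed.

Local Notation lift_seq := [seq vertex_lift p o G_connected a | a <- vertices G].

Lemma lift_fun_lcc (F : Clc K (chain G)) : (fun c : chain T =>
  (src (c 0%N) \in lift_seq)%:R * F (cmap p c) : K^o) \in lcc_pred.
Proof.
pose A := [set c : chain T | [set` lift_seq] (src (c 0%N))].
have cA : compact A.
  apply: chain_compact; first exact: finite_seq.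
  by apply: (finite_neighbours p); exact: finite_neighbours_fin.
apply/asboolP; split.
  apply: lc_mul; last first.
    move=> c; have /lc_chainP/(_ (cmap p c))[n nF] := Clc_lc F.
    by apply/nbhs_chain; exists n => d cd; exact/nF/cylinder_cmap.
  by move=> c; apply: filterS (near_chain_src c) => d ->.
apply: subclosed_compact cA _; first exact: closed_closure.
(* The first edge decides membership in [A], so the complement is open. *)
have clA : closed A.
  rewrite -openC; apply: open_chain => c cA; exists 1%N => d /(_ 0%N isT) cd.
  by rewrite /A /setC /= cd.
rewrite (closure_id A).1//; apply: closureS => c /=; rewrite /A /=.
by case: (_ \in _) => //; rewrite mul0r eqxx.
Qed.

(** [F] is lifted to the chains of [T] that start at the chosen representatives of the fibers; over
    each chain of [G] exactly one of these contributes. This makes [path_pull] injective. *)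
Lemma path_push_surj (F : Clc K (chain G)) : exists f, path_push p f = F.
Proof.
exists (MkClcc (lift_fun_lcc F)); set f := MkClcc _.
have lift_inj : injective (vertex_lift p o G_connected).
  by move=> a b ab; rewrite -[a](vertex_liftK p o G_connected) ab vertex_liftK.
rewrite (@path_push_sum lift_seq).
- rewrite big_map; apply: Clc_eqP => d; rewrite Clc_sumE.
  rewrite (@vertices_sum1 _ _ (src (d 0%N))) => [|a ad]; last first.
    by apply: path_ext0; rewrite vertex_liftK.
  set x := vertex_lift _ _ _ _.
  have [w <-] : exists w, proj_path p x w = d.
    by apply: proj_path_surj; rewrite vertex_liftK.
  rewrite /= path_extE /= chain_from0 map_f ?mul1r//; exact: mem_vertices.
- by rewrite map_inj_uniq//; exact: fset_uniq.
- by move=> c; rewrite /= => /negPf ->; rewrite mul0r.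
Qed.

Lemma path_pull_inj u v : path_pull p u = path_pull p v -> u = v.
Proof.
move=> uv; apply: dual_eqP => F; have [f <-] := path_push_surj F.
exact: (congr1 (fun q => q f) uv).
Qed.

End PathPush.

Theorem theoremB (R : realType) (G : fin_graph) (T : tree)
  (p : covering T G) (o : T) (z : R[i])
  (G_connected : connected_graph G) (G_no_dead_ends : no_dead_ends G)
  (z_neq0 : z != 0) :
  [/\ (forall mu, invariants o z (deck p) mu ->
         forall g, deck p g -> forall e,
         edge_poisson o z mu (emap g e) = edge_poisson o z mu e) /\
      (exists Phi : alg_dual (Clc R[i] (boundary T)) -> (dedge G -> R[i]^o),
         linear_iso (invariants o z (deck p))
           (op_eigenspace (@edge_laplacian R[i] G) z) Phi /\
         forall mu, invariants o z (deck p) mu ->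
         forall e, Phi mu (emap p e) = edge_poisson o z mu e),
      (exists Phi : alg_dual (Clc R[i] (boundary T)) ->
                    alg_dual (Clc R[i] (chain G)),
         linear_iso (invariants o z (deck p))
           (op_eigenspace (transpose (@transfer_op R[i] G)) z) Phi /\
         forall mu, invariants o z (deck p) mu ->
         forall u, path_pull p u = p_z_mul o z (B_pull mu) <-> u = Phi mu),
      (exists Phi : alg_dual (Clc R[i] (chain G)) -> Clc R[i] (chain G),
         linear_iso (op_eigenspace (transpose (@transfer_op R[i] G)) z)
           (op_eigenspace (@transfer_op R[i] G) z) Phi) &
      (exists Phi : (dedge G -> R[i]^o) -> Clc R[i] (chain G),
         linear_iso (op_eigenspace (@edge_laplacian R[i] G) z)
           (op_eigenspace (@transfer_op R[i] G) z) Phi)].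
Proof.
have edge_iso := edge_values_iso G_no_dead_ends z_neq0.
have rev_iso := reverse_first_iso G_no_dead_ends z_neq0.
(* [Psi] inverts the boundary value map; it is the isomorphism of (2), and the one of (1) after
   passing to edge values. *)
have [Psi [Psi_iso _ PsiK]] :=
  linear_iso_inv (boundary_value_iso p o G_connected G_no_dead_ends z_neq0).
have PsiP mu : invariants o z (deck p) mu ->
    op_eigenspace (transpose (@transfer_op R[i] G)) z (Psi mu).
  by case: Psi_iso => _ _ _ [+ _ _]; apply.
have poissonE mu e : invariants o z (deck p) mu ->
    edge_poisson o z mu e = edge_values (Psi mu) (emap p e).
  move=> imu; rewrite -{1}(PsiK _ imu).
  by apply: edge_poisson_boundary_value => //; exact: PsiP.
split.
- split=> [mu imu g dg e|]; first by rewrite !poissonE// emap_deck.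
  exists (@edge_values _ G \o Psi); split; first exact: linear_iso_comp edge_iso.
  by move=> mu imu e; rewrite poissonE.
(* With [mu] written as the boundary value of [Psi mu], the right side becomes
   [path_pull p (Psi mu)], and injectivity of [path_pull] gives uniqueness. *)
- exists Psi; split=> // mu imu u; rewrite -{1}(PsiK _ imu).
  rewrite -path_pull_boundary_value//; last exact: PsiP.
  by split=> [|-> //]; exact: path_pull_inj.
- exists (@reverse_first _ G \o @edge_values _ G); exact: linear_iso_comp rev_iso.
- by exists (@reverse_first _ G).
Qed.
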